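(* Let $d>0$ be an integer, let $\Lambda$ be a finite-dimensional algebra which is Iwanaga-Gorenstein, and let $\mathcal{M}$ be a $d\mathbb{Z}$-cluster tilting subcategory of $\operatorname{mod}\Lambda$. Then $\mathcal{M}\cap \mathcal{GP}(\operatorname{mod}\Lambda)$ is a $d\mathbb{Z}$-cluster tilting subcategory of $\mathcal{GP}(\operatorname{mod}\Lambda)$.
   Context: $\operatorname{mod}\Lambda$ is the category of finitely generated right $\Lambda$-modules. $\Lambda$ is Iwanaga-Gorenstein if it has finite selfinjective dimension (on both sides). In this case $$\mathcal{GP}(\operatorname{mod}\Lambda)=\{M\in\operatorname{mod}\Lambda\mid \operatorname{Ext}^i_\Lambda(M,\Lambda)=0\text{ for } i>0\},$$ the Gorenstein projective modules. It is closed under extensions in $\operatorname{mod}\Lambda$ and is regarded as an exact category, whose exact sequences are those short exact sequences of $\operatorname{mod}\Lambda$ with all terms in $\mathcal{GP}(\operatorname{mod}\Lambda)$. Cluster tilting: let $\mathcal{A}$ be an exact category (for instance $\operatorname{mod}\Lambda$). A full subcategory $\mathcal{N}\subseteq\mathcal{A}$ is $d$-cluster tilting if (1) $\mathcal{N}$ is functorially finite in $\mathcal{A}$, i.e. for each $A\in\mathcal{A}$ there is a morphism $N\to A$ with $N\in\mathcal{N}$ such that $\operatorname{Hom}(N',N)\to\operatorname{Hom}(N',A)$ is surjective for all $N'\in\mathcal{N}$, and a morphism $A\to N$ with $N\in\mathcal{N}$ such that $\operatorname{Hom}(N,N')\to\operatorname{Hom}(A,N')$ is surjective for all $N'\in\mathcal{N}$;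 (2) $\mathcal{N}=\{A\mid \operatorname{Ext}^i_{\mathcal{A}}(A,\mathcal{N})=0,\ 1\le i\le d-1\}=\{A\mid \operatorname{Ext}^i_{\mathcal{A}}(\mathcal{N},A)=0,\ 1\le i\le d-1\}$; (3) for every $A\in\mathcal{A}$ there are an admissible monomorphism $A\to N$ and an admissible epimorphism $N'\to A$ with $N,N'\in\mathcal{N}$. It is $d\mathbb{Z}$-cluster tilting if moreover $\operatorname{Ext}^i_{\mathcal{A}}(\mathcal{N},\mathcal{N})=0$ for all $i\notin d\mathbb{Z}$. *)

(* Defs.v *)
From HB Require Import structures.
From Stdlib Require Import Relation_Operators.
From mathcomp Require Import all_boot all_order all_algebra all_field.

Set Implicit Arguments.
Unset Strict Implicit.
Unset Printing Implicit Defensive.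

Import GRing.Theory.
Local Open Scope ring_scope.

(* Modules over R are left R-modules ([lmodType R]).  A right module over an
   algebra L is a left module over the converse ring L^c, for which
   a *: x stands for "x a". *)

(* A full subcategory of the category of R-modules, given by its objects. *)
Definition subcat (R : nzRingType) := lmodType R -> Prop.

(* mod R *)
Definition fgmod (R : nzRingType) : subcat R := fun M =>
  exists s : seq M, forall x : M,
    exists c : 'I_(size s) -> R, x = \sum_(i < size s) c i *: s`_i.

Definition short_exact (R : nzRingType) (K E Q : lmodType R)
    (f : {linear K -> E}) (g : {linear E -> Q}) : Prop :=
  [/\ injective f,
      forall x : E, g x = 0 <-> exists y : K, f y = x
    & forall z : Q, exists x : E, g x = z].

Section ExactCategory.

(* In this section CA is a full extension-closed subcategory of mod R, with the
   exact structure given by the short exact sequences with all terms in CA. *)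
Variables (R : nzRingType) (CA : subcat R).

(* Exact sequences 0 -> B -> E -> A -> 0 of CA. *)
Record conflation (A B : lmodType R) := Conflation {
  cmid : lmodType R;
  cinc : {linear B -> cmid};
  cprj : {linear cmid -> A};
  _ : short_exact cinc cprj;
  _ : [/\ CA B, CA cmid & CA A]
}.

(* Morphisms of exact sequences inducing a and b on the end terms. *)
Definition conflation_mor (A B A' B' : lmodType R) (a : A -> A') (b : B -> B')
    (xi : conflation A B) (xi' : conflation A' B') : Prop :=
  exists e : {linear cmid xi -> cmid xi'},
    (forall x, e (cinc xi x) = cinc xi' (b x)) /\
    (forall x, cprj xi' (e x) = a (cprj xi x)).

(* [yext n A B] is the type of (n+1)-fold extensions
     0 -> B -> E_n -> ... -> E_0 -> A -> 0
   in CA, i.e. of the sequences spliced from n+1 short exact sequences of CA. *)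
Fixpoint yext (n : nat) (A B : lmodType R) : Type :=
  match n with
  | 0 => conflation A B
  | m.+1 => {K : lmodType R & (conflation A K * yext m K B)%type}
  end.

(* Morphisms of (n+1)-fold extensions inducing a and b on the end terms. *)
Fixpoint yext_mor (n : nat) : forall (A B A' B' : lmodType R),
    (A -> A') -> (B -> B') -> yext n A B -> yext n A' B' -> Prop :=
  match n with
  | 0 => fun A B A' B' a b xi xi' => conflation_mor a b xi xi'
  | m.+1 => fun A B A' B' a b xi xi' =>
      exists k : {linear projT1 xi -> projT1 xi'},
        conflation_mor a k (projT2 xi).1 (projT2 xi').1 /\
        yext_mor k b (projT2 xi).2 (projT2 xi').2
  end.

(* Yoneda equivalence: the equivalence relation generated by the morphisms
   that are the identity on both end terms. *)
Definition yext_equiv (n : nat) (A B : lmodType R) :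
    yext n A B -> yext n A B -> Prop :=
  clos_refl_sym_trans (yext n A B) (@yext_mor n A B A B id id).

(* Ext^i_CA(A, B) = 0 for the Yoneda Ext groups of the exact category CA:
   Ext^0 is Hom, and for i > 0 the group Ext^i is the set of Yoneda classes of
   i-fold extensions, which is zero iff it has only one element. *)
Definition Ext_zero (i : nat) (A B : lmodType R) : Prop :=
  match i with
  | 0 => forall (f : {linear A -> B}) (x : A), f x = 0
  | n.+1 => forall xi xi' : yext n A B, yext_equiv xi xi'
  end.

Definition functorially_finite (CN : subcat R) : Prop :=
  forall A : lmodType R, CA A ->
    (exists (N : lmodType R) (f : {linear N -> A}), CN N /\
       forall N' : lmodType R, CN N' -> forall g : {linear N' -> A},
         exists h : {linear N' -> N}, forall x, g x = f (h x)) /\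
    (exists (N : lmodType R) (f : {linear A -> N}), CN N /\
       forall N' : lmodType R, CN N' -> forall g : {linear A -> N'},
         exists h : {linear N -> N'}, forall x, g x = h (f x)).

Record cluster_tilting (d : nat) (CN : subcat R) : Prop := ClusterTilting {
  ct_sub : forall A, CN A -> CA A;
  ct_ff : functorially_finite CN;
  ct_left : forall A, CN A <->
    CA A /\ forall X, CN X -> forall i, (1 <= i <= d.-1)%N -> Ext_zero i A X;
  ct_right : forall A, CN A <->
    CA A /\ forall X, CN X -> forall i, (1 <= i <= d.-1)%N -> Ext_zero i X A;
  ct_cogen : forall A, CA A ->
    exists (C : lmodType R) (xi : conflation C A), CN (cmid xi);
  ct_gen : forall A, CA A ->
    exists (K : lmodType R) (xi : conflation A K), CN (cmid xi)
}.

(* Ext^i vanishes by convention for i < 0, hence i ranges over nat. *)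
Definition dZ_cluster_tilting (d : nat) (CN : subcat R) : Prop :=
  cluster_tilting d CN /\
  forall X Y, CN X -> CN Y -> forall i : nat, ~~ (d %| i)%N -> Ext_zero i X Y.

End ExactCategory.

(* Injective objects of mod R. *)
Definition fg_injective (R : nzRingType) (I : lmodType R) : Prop :=
  fgmod I /\
  forall (M N : lmodType R) (f : {linear M -> N}) (g : {linear M -> I}),
    fgmod M -> fgmod N -> injective f ->
    exists h : {linear N -> I}, forall x, g x = h (f x).

(* M has an injective resolution 0 -> M -> I^0 -> ... -> I^n -> 0 in mod R. *)
Fixpoint injdim_le (R : nzRingType) (n : nat) (M : lmodType R) : Prop :=
  match n with
  | 0 => fg_injective M
  | m.+1 => exists (I C : lmodType R) (f : {linear M -> I}) (g : {linear I -> C}),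
      [/\ fg_injective I, short_exact f g & injdim_le m C]
  end.

Definition Iwanaga_Gorenstein (R : nzRingType) : Prop :=
  (exists n, injdim_le n (R^o : lmodType R)) /\
  (exists n, injdim_le n ((R^c)^o : lmodType R^c)).

Definition Gorenstein_projective (R : nzRingType) : subcat R := fun M =>
  fgmod M /\ forall i : nat, (0 < i)%N -> Ext_zero (@fgmod R) i M (R^o : lmodType R).

(* Main.v *)
From HB Require Import structures.
Require Import Defs.
From Stdlib Require Import Relation_Operators ClassicalEpsilon.
From mathcomp Require Import all_boot all_order all_algebra all_field.

Set Implicit Arguments.
Unset Strict Implicit.
Unset Printing Implicit Defensive.

Import GRing.Theory.
Local Open Scope ring_scope.

(** Write [R] for [L^c], [CMgp] for the intersection of [CM] with the Gorenstein
    projectives, and call the kernel of an epimorphism from a finitely generated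
    projective a syzygy.

    Passage to Hom. Yoneda Ext is awkward to compute with, but in an exact
    subcategory of mod R that contains the projectives and is closed under
    extensions and syzygies, [Ext_zeroP] identifies the vanishing of Ext^(n+1)(A, B)
    with the extendability of all maps into B along the last inclusion of a
    projective resolution of A. This condition mentions no subcategory, so Ext
    vanishing over GP and over mod R agree, and the long exact sequences
    become diagram chases on the horseshoe lemma.

    Frobenius property. Since R has finite injective dimension, high syzygies are
    Gorenstein projective ([gp_syzygy_injdim]). Conversely every Gorenstein
    projective A embeds in a projective with Gorenstein projective cokernel. The
    cokernel of a left projective approximation has no Ext to R, so it is enough
    that A is torsionless. This is where the injective dimension of L as a left
    module enters: the dual Hom(A, R) of a Gorenstein projective is an n-th
    syzygy for every n, hence has no Ext^1 to L, and then dualizing a presentation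
    of A twice gives it back ([gp_torsionless]).

    Shifting by multiples of d. As Ext^i(CM, CM) = 0 for i not divisible by d, CM
    is closed under d-th syzygies. Ext from a Gorenstein projective is
    unchanged when a syzygy is taken in the second variable and the degree is
    raised by one ([gp_shift]), which makes CMgp closed under d-th cosyzygies too.
    So for Z in CM, a high syzygy of order a multiple m of d lies in CMgp, and so
    does its m-th cosyzygy Y, and Z and Y have the same Ext from Gorenstein
    projectives. Hence a Gorenstein projective left orthogonal to CMgp is left
    orthogonal to CM, and belongs to it ([CMgp_left]). In the same way,
    approximating an m-th cosyzygy of A by an object of CM and then taking m-th
    syzygies gives approximations of A by CMgp, up to maps through projectives,
    which are absorbed by a projective summand.

    The right orthogonal. The shift has no counterpart in the first variable. If A
    is Gorenstein projective and right orthogonal to CMgp, take successive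
    injective left approximations A -> N0 -> ... -> N_(d-2) with last cokernel Y.
    The approximation property makes Y left orthogonal to CMgp, so Y is in CMgp.
    Then Ext^(d-1)(Y, A) = 0, which by dimension shifting splits A -> N0
    ([CMgp_right]). *)

(** * Linear maps, submodules and quotients *)

Lemma choice_fun (S T : Type) (P : S -> T -> Prop) :
  (forall x, exists y, P x y) -> exists f, forall x, P x (f x).
Proof.
move=> ex; exists (fun x => proj1_sig (constructive_indefinite_description _ (ex x))) => x.
exact: (proj2_sig (constructive_indefinite_description _ (ex x))).
Qed.

Section Constructions.
Variable R : nzRingType.
Implicit Types A B E K Q U V X : lmodType R.

Lemma lin_exists U V (h : U -> V) :
  (forall a x y, h (a *: x + y) = a *: h x + h y) ->
  exists h' : {linear U -> V}, h' =1 h.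
Proof.
move=> hl; pose h' : {linear U -> V} := HB.pack h (GRing.isLinear.Build R U V *:%R h hl).
by exists h'.
Qed.

Lemma ses_factor K E Q (f : {linear K -> E}) (g : {linear E -> Q}) X
    (h : {linear E -> X}) :
  short_exact f g -> (forall x, h (f x) = 0) ->
  exists h' : {linear Q -> X}, forall x, h' (g x) = h x.
Proof.
move=> [_ fg gs] hf.
have hg x y : g x = g y -> h x = h y.
  move=> e; have /fg [z zE] : g (x - y) = 0 by rewrite linearB /= e subrr.
  by apply/eqP; rewrite -subr_eq0 -linearB /= -zE hf.
have [c cE] := choice_fun gs.
have [|h' h'E] := @lin_exists Q X (h \o c).
  by move=> a x y; rewrite /= -linearP; apply: hg; rewrite linearP /= !cE.
by exists h' => x; rewrite h'E; apply: hg.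
Qed.

Lemma ses_lift K E Q (f : {linear K -> E}) (g : {linear E -> Q}) X
    (h : {linear X -> E}) :
  short_exact f g -> (forall x, g (h x) = 0) ->
  exists h' : {linear X -> K}, forall x, f (h' x) = h x.
Proof.
move=> [fi fg _] gh.
have [c cE] := choice_fun (fun x => (fg (h x)).1 (gh x)).
have [|h' h'E] := @lin_exists X K c.
  by move=> a x y; apply: fi; rewrite linearP !cE linearP.
by exists h' => x; rewrite h'E.
Qed.

Section Sub.
Variables (E : lmodType R) (p : {pred E}).
Hypothesis pP : submod_closed p.
HB.instance Definition _ := GRing.isSubmodClosed.Build R E p pP.
Definition submodule_sort := {x | x \in p}.
HB.instance Definition _ := SubChoice.on submodule_sort.
HB.instance Definition _ := [SubChoice_isSubLmodule of submodule_sort by <:].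
Definition submodule : lmodType R := submodule_sort.
Definition submodule_val : {linear submodule -> E} := (val : submodule_sort -> E).
End Sub.

(** The algebraic substructures of the library are cut out by boolean predicates, so
    excluded middle turns a propositional submodule into one of them. *)
Lemma submod_pred_exists E (P : E -> Prop) :
  P 0 -> (forall a x y, P x -> P y -> P (a *: x + y)) ->
  exists2 p : {pred E}, submod_closed p & forall x, x \in p <-> P x.
Proof.
move=> P0 Pl; pose p : {pred E} :=
  fun x => if excluded_middle_informative (P x) then true else false.
have pE x : x \in p <-> P x by rewrite unfold_in; case: excluded_middle_informative.
by exists p => //; split=> [|a x y /pE hx /pE hy]; apply/pE => //; apply: Pl.
Qed.

Lemma submodule_exists E (P : E -> Prop) :
  P 0 -> (forall a x y, P x -> P y -> P (a *: x + y)) ->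
  exists K (f : {linear K -> E}), injective f /\ forall x, P x <-> exists y, f y = x.
Proof.
move=> P0 Pl; have [p pP pE] := submod_pred_exists P0 Pl.
exists (submodule pP), (submodule_val pP); split; first exact: val_inj.
move=> x; split=> [/pE hx|[y <-]]; first by exists (exist _ x hx).
exact/pE/(valP y).
Qed.

Lemma kernel_exists E Q (g : {linear E -> Q}) :
  (forall z, exists x, g x = z) -> exists K (f : {linear K -> E}), short_exact f g.
Proof.
move=> gs; have [||K [f [fi fP]]] := @submodule_exists E (fun x => g x = 0).
- exact: linear0.
- by move=> a x y gx gy; rewrite linearP /= gx gy scaler0 addr0.
by exists K, f.
Qed.

Section Quotient.
Variables (E : lmodType R) (p : {pred E}).
Hypothesis pP : submod_closed p.
HB.instance Definition _ := GRing.isSubmodClosed.Build R E p pP.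

(** Quotients are realized on canonical coset representatives: [choose] depends only on
    the extension of the predicate, so two elements of a coset get the same one. *)
Definition coset_rep (x : E) : E := choose (fun y => y - x \in p) x.

Lemma coset_repP x : coset_rep x - x \in p.
Proof.
apply: (@chooseP _ (fun y => y - x \in p)) => /=.
by rewrite subrr pP.1.
Qed.

Lemma coset_rep_eq x y : x - y \in p -> coset_rep x = coset_rep y.
Proof.
move=> xy; rewrite /coset_rep.
have e : (fun z => z - x \in p) =1 (fun z => z - y \in p).
  move=> z; apply/idP/idP => hz.
    by rewrite -[z - y](subrKA x) rpredD.
  by rewrite -[z - x](subrKA y) rpredD // -opprB rpredN.
rewrite (eq_choose e); apply: choose_id => //=.
by rewrite subrr pP.1.
Qed.

Lemma coset_rep_eqP x y : coset_rep x = coset_rep y <-> x - y \in p.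
Proof.
split=> [e|]; last exact: coset_rep_eq.
rewrite -[x - y](subrKA (coset_rep x)) rpredD //; last by rewrite e coset_repP.
by rewrite -opprB rpredN coset_repP.
Qed.

Lemma coset_repK x : coset_rep (coset_rep x) = coset_rep x.
Proof. exact/coset_rep_eq/coset_repP. Qed.

Definition quotient_sort := {x : E | coset_rep x == x}.
HB.instance Definition _ := Choice.on quotient_sort.
Definition quotient_pi (x : E) : quotient_sort := exist _ (coset_rep x) (introT eqP (coset_repK x)).

Lemma quotient_piE x y : quotient_pi x = quotient_pi y <-> x - y \in p.
Proof.
split=> [[/coset_rep_eqP]//|/coset_rep_eqP e]; exact: val_inj.
Qed.

Lemma quotient_piK (u : quotient_sort) : quotient_pi (val u) = u.
Proof. by apply: val_inj; apply/eqP/(valP u). Qed.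

Let add (u v : quotient_sort) := quotient_pi (val u + val v).
Let opp (u : quotient_sort) := quotient_pi (- val u).
Let scale (a : R) (u : quotient_sort) := quotient_pi (a *: val u).

Lemma quotient_rep x : val (quotient_pi x) - x \in p. Proof. exact: coset_repP. Qed.

Let addE x y : add (quotient_pi x) (quotient_pi y) = quotient_pi (x + y).
Proof. by apply/quotient_piE; rewrite opprD addrACA rpredD ?quotient_rep. Qed.
Let oppE x : opp (quotient_pi x) = quotient_pi (- x).
Proof. by apply/quotient_piE; rewrite -opprD rpredN quotient_rep. Qed.
Let scaleE a x : scale a (quotient_pi x) = quotient_pi (a *: x).
Proof. by apply/quotient_piE; rewrite -scalerBr rpredZ ?quotient_rep. Qed.

Let quotient_addA : associative add.
Proof.
by move=> u v w; rewrite -(quotient_piK u) -(quotient_piK v) -(quotient_piK w) !addE addrA.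
Qed.
Let quotient_addC : commutative add.
Proof. by move=> u v; rewrite /add addrC. Qed.
Let quotient_add0 : left_id (quotient_pi 0) add.
Proof. by move=> u; rewrite -(quotient_piK u) addE add0r. Qed.
Let quotient_addN : left_inverse (quotient_pi 0) opp add.
Proof. by move=> u; rewrite -(quotient_piK u) oppE addE addNr. Qed.
HB.instance Definition _ := GRing.isZmodule.Build quotient_sort
  quotient_addA quotient_addC quotient_add0 quotient_addN.

Let quotient_scaleA a b (u : quotient_sort) : scale a (scale b u) = scale (a * b) u.
Proof. by rewrite -(quotient_piK u) !scaleE scalerA. Qed.
Let quotient_scale1 : left_id 1 scale.
Proof. by move=> u; rewrite -(quotient_piK u) scaleE scale1r. Qed.
Let quotient_scaleDr : right_distributive scale +%R.
Proof.
move=> a u v; rewrite -(quotient_piK u) -(quotient_piK v) [in LHS]/GRing.add/= addE !scaleE.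
by rewrite [RHS]addE scalerDr.
Qed.
Let quotient_scaleDl (u : quotient_sort) : {morph scale^~ u : a b / a + b}.
Proof.
by move=> a b; rewrite -(quotient_piK u) !scaleE [RHS]addE scalerDl.
Qed.
HB.instance Definition _ := GRing.Zmodule_isLmodule.Build R quotient_sort
  quotient_scaleA quotient_scale1 quotient_scaleDr quotient_scaleDl.

Definition quotient : lmodType R := quotient_sort.

Lemma quotient_exists : exists (Q : lmodType R) (g : {linear E -> Q}),
  (forall x, g x = 0 <-> x \in p) /\ forall z, exists x, g x = z.
Proof.
exists quotient; have [|g gE] := @lin_exists E quotient quotient_pi.
  by move=> a x y; rewrite -[RHS]/(add (scale a (quotient_pi x)) (quotient_pi y)) scaleE addE.
exists g; split=> [x|z]; last by exists (val z); rewrite gE quotient_piK.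
by rewrite gE -[0]/(quotient_pi 0) quotient_piE subr0.
Qed.
End Quotient.

Lemma cokernel_exists K E (f : {linear K -> E}) :
  injective f -> exists Q (g : {linear E -> Q}), short_exact f g.
Proof.
move=> fi; have [||p pP pE] := @submod_pred_exists E (fun x => exists y, f y = x).
- by exists 0; rewrite linear0.
- by move=> a x y [x' <-] [y' <-]; exists (a *: x' + y'); rewrite linearP.
have [Q [g [gE gs]]] := quotient_exists pP.
by exists Q, g; split=> // x; rewrite gE pE.
Qed.

End Constructions.

(** * Finitely generated projectives *)

Section Projectives.
Variable R : nzRingType.
Implicit Types A B C E K M N Q U V X P W : lmodType R.

Definition surj U V (g : U -> V) := forall z, exists x, g x = z.

Section Prod.
Variables U V X : lmodType R.
Definition inl_fun (x : U) : U * V := (x, 0).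
Definition inr_fun (x : V) : U * V := (0, x).
Fact inl_is_linear : linear inl_fun.
Proof. by move=> a x y; congr (_, _); rewrite /= scaler0 addr0. Qed.
Fact inr_is_linear : linear inr_fun.
Proof. by move=> a x y; congr (_, _); rewrite /= scaler0 addr0. Qed.
HB.instance Definition _ := GRing.isLinear.Build R U (U * V)%type *:%R inl_fun inl_is_linear.
HB.instance Definition _ := GRing.isLinear.Build R V (U * V)%type *:%R inr_fun inr_is_linear.
Definition pr1 : {linear (U * V)%type -> U} := (fst : U * V -> U).
Definition pr2 : {linear (U * V)%type -> V} := (snd : U * V -> V).
Definition in1 : {linear U -> (U * V)%type} := inl_fun.
Definition in2 : {linear V -> (U * V)%type} := inr_fun.

Lemma ses_prod : short_exact in1 pr2.
Proof.
split=> [x y [] //|[x y] /=|z]; last by exists (0, z).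
by split=> [->|[x' [_ <-]]] //; exists x.
Qed.

Lemma in1Din2 (x : U * V) : in1 x.1 + in2 x.2 = x.
Proof. by case: x => u v; congr (_, _); rewrite /= ?addr0 ?add0r. Qed.
End Prod.

Lemma copair_exists U V X (f : {linear U -> X}) (g : {linear V -> X}) :
  exists h : {linear (U * V)%type -> X}, forall x, h x = f x.1 + g x.2.
Proof.
have [|h hE] := @lin_exists R (U * V)%type X (fun x => f x.1 + g x.2).
  by move=> a x y; rewrite /= !linearP scalerDr addrACA.
by exists h.
Qed.

Lemma pair_exists U V X (f : {linear X -> U}) (g : {linear X -> V}) :
  exists h : {linear X -> (U * V)%type}, forall x, h x = (f x, g x).
Proof.
have [|h hE] := @lin_exists R X (U * V)%type (fun x => (f x, g x)).
  by move=> a x y; congr (_, _); rewrite /= linearP.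
by exists h.
Qed.

Definition projective P := forall E Q (g : {linear E -> Q}) (h : {linear P -> Q}),
  surj g -> exists h' : {linear P -> E}, forall x, g (h' x) = h x.

Lemma row_map_exists n M (s : 'I_n -> M) :
  exists h : {linear 'rV[R]_n -> M}, forall v, h v = \sum_i v 0 i *: s i.
Proof.
have [|h hE] := @lin_exists R 'rV[R]_n M (fun v => \sum_i v 0 i *: s i); last by exists h.
move=> a x y; rewrite scaler_sumr -big_split; apply: eq_bigr => i _ /=.
by rewrite !mxE scalerDl scalerA.
Qed.

Lemma row_map_delta n M (h : {linear 'rV[R]_n -> M}) v :
  h v = \sum_i v 0 i *: h (delta_mx 0 i).
Proof.
by rewrite {1}[v]row_sum_delta linear_sum; apply: eq_bigr => i _; rewrite linearZ.
Qed.

(** A map out of a free module is given by the images of the standard basis. *)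
Lemma row_projective n : projective 'rV[R]_n.
Proof.
move=> E Q g h gs; have [s sE] := choice_fun (fun i : 'I_n => gs (h (delta_mx 0 i))).
have [h' h'E] := row_map_exists s; exists h' => v.
rewrite h'E linear_sum row_map_delta; apply: eq_bigr => i _.
by rewrite linearZ /= sE.
Qed.

Lemma fgmodP M : fgmod M <-> exists n (g : {linear 'rV[R]_n -> M}), surj g.
Proof.
split=> [[s sP]|[n [g gs]]].
  have [g gE] := row_map_exists (fun i : 'I_(size s) => s`_i).
  exists _, g => x; have [c ->] := sP x; exists (\row_i c i).
  by rewrite gE; apply: eq_bigr => i _; rewrite mxE.
pose s := [seq g (delta_mx 0 i) | i <- enum 'I_n].
have es : size s = n by rewrite size_map size_enum_ord.
exists s => x; have [v <-] := gs x; exists (fun i => v 0 (cast_ord es i)).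
rewrite row_map_delta (reindex (cast_ord es)) /=.
  apply: eq_bigr => i _; congr (_ *: _); rewrite (nth_map (cast_ord es i)).
    by congr (g (delta_mx 0 _)); apply: val_inj; rewrite /= nth_enum_ord // -es.
  by rewrite size_enum_ord -es.
by exists (cast_ord (esym es)) => i _; rewrite ?cast_ordK ?cast_ordKV.
Qed.

Definition fgproj P := fgmod P /\ projective P.

Lemma row_fgproj n : fgproj 'rV[R]_n.
Proof.
split; last exact: row_projective.
by apply/fgmodP; exists n, idfun => x; exists x.
Qed.

Lemma prod_projective P Q : projective P -> projective Q -> projective (P * Q)%type.
Proof.
move=> pP pQ E X g h gs.
have [h1 h1E] := pP _ _ g (h \o in1 P Q) gs.
have [h2 h2E] := pQ _ _ g (h \o in2 P Q) gs.
have [k kE] := copair_exists h1 h2; exists k => x.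
by rewrite kE linearD h1E h2E /= -linearD in1Din2.
Qed.

Lemma fgmod_surj E Q (g : {linear E -> Q}) : surj g -> fgmod E -> fgmod Q.
Proof.
move=> gs /fgmodP[n [h hs]]; apply/fgmodP; exists n, (g \o h) => z.
by have [x <-] := gs z; have [v <-] := hs x; exists v.
Qed.

Lemma fgmod_ext K E Q (f : {linear K -> E}) (g : {linear E -> Q}) :
  short_exact f g -> fgmod K -> fgmod Q -> fgmod E.
Proof.
move=> [_ fg gs] /fgmodP[n [h hs]] /fgmodP[m [k ks]].
have [k' k'E] := row_projective k gs.
have [r rE] := copair_exists (f \o h) k'.
apply: (fgmod_surj (g := r)).
  move=> x; have [v vE] := ks (g x).
  have /fg[y yE] : g (x - k' v) = 0 by rewrite linearB /= k'E vE subrr.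
  have [w wE] := hs y; exists (w, v).
  by rewrite rE /= wE yE subrK.
apply/fgmodP; exists (n + m)%N.
have [u uE] := @pair_exists _ _ 'rV[R]_(n + m) (@lsubmx R 1 n m) (@rsubmx R 1 n m).
by exists u => -[a b]; exists (row_mx a b); rewrite uE /= row_mxKl row_mxKr.
Qed.

Lemma fgproj_prod P Q : fgproj P -> fgproj Q -> fgproj (P * Q)%type.
Proof.
move=> [fP pP] [fQ pQ]; split; last exact: prod_projective.
exact: fgmod_ext (ses_prod P Q) fP fQ.
Qed.

Lemma cover_exists A : fgmod A -> exists P K (f : {linear K -> P}) (g : {linear P -> A}),
  fgproj P /\ short_exact f g.
Proof.
move=> /fgmodP[n [g gs]]; have [K [f fg]] := kernel_exists gs.
by exists _, K, f, g; split; first exact: row_fgproj.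
Qed.

Lemma fgproj_retract P : fgproj P -> exists n (i : {linear P -> 'rV[R]_n})
  (r : {linear 'rV[R]_n -> P}), forall x, r (i x) = x.
Proof.
move=> [/fgmodP[n [g gs]] pP]; have [i iE] := pP _ _ g idfun gs.
by exists n, i, g.
Qed.

(** Vanishing of Ext^1(A, B), in the form of the surjectivity of Hom(E, B) -> Hom(K, B)
    for all short exact sequences ending in A. *)
Definition ext1_zero A B := forall K E (f : {linear K -> E}) (g : {linear E -> A}),
  short_exact f g -> forall u : {linear K -> B},
  exists v : {linear E -> B}, forall x, v (f x) = u x.

(** Every short exact sequence K' -> E -> A is a pushout of a projective presentation
    K -> P -> A: lifting P -> A to E makes K' x P -> E an epimorphism, whose kernel
    is a copy of K. *)
Lemma ext1_pres A B K P (f : {linear K -> P}) (g : {linear P -> A}) :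
  projective P -> short_exact f g ->
  (forall u : {linear K -> B}, exists v : {linear P -> B}, forall x, v (f x) = u x) ->
  ext1_zero A B.
Proof.
move=> pP fg ex K' E f' g' f'g' u.
have [fi fgE gs] := fg; have [f'i f'g'E g's] := f'g'.
have [t tE] := pP _ _ g' g g's.
have [|k kE] := @ses_lift _ _ _ _ f' g' _ (t \o f) f'g'.
  by move=> x; rewrite /= tE; apply/fgE; exists x.
have [v vE] := ex (u \o k).
have [s sE] := copair_exists f' t; have [w wE] := copair_exists u v.
have ss : surj s.
  move=> x; have [p pE] := gs (g' x).
  have /f'g'E[y yE] : g' (x - t p) = 0 by rewrite linearB /= tE pE subrr.
  by exists (y, p); rewrite sE /= yE subrK.
have [N [j jE]] := kernel_exists ss.
have [|w' w'E] := @ses_factor _ _ _ _ j s _ w jE.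
  move=> x; have : s (j x) = 0 by case: jE => _ -> _; exists x.
  case: (j x) => y p; rewrite sE wE /= => e.
  have /fgE[z zE] : g p = 0.
    have := congr1 g' e; rewrite linearD linear0 /= tE.
    by have -> : g' (f' y) = 0; [apply/f'g'E; exists y | rewrite add0r].
  have -> : y = - k z.
    by apply: f'i; apply/eqP; rewrite linearN /= kE /= zE -addr_eq0 e.
  by rewrite -zE vE linearN /= addNr.
exists w' => x; have := w'E (x, 0); rewrite sE wE /= !linear0 !addr0; exact.
Qed.
End Projectives.

(** * Yoneda extensions and projective resolutions *)

Section Syzygies.
Variable R : nzRingType.
(** [W] is an [n]-th syzygy of [A]; it is determined only up to projective summands. *)
Fixpoint syzygy (n : nat) (A W : lmodType R) : Prop :=
  match n with
  | 0 => A = W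
  | m.+1 => exists (K P : lmodType R) (f : {linear K -> P}) (g : {linear P -> A}),
      [/\ fgproj P, short_exact f g & syzygy m K W]
  end.
End Syzygies.

Section Yoneda.
Variables (R : nzRingType) (CA : subcat R).
Implicit Types A B E K M N Q U V X P W : lmodType R.

(** The closure properties under which Ext vanishing can be tested on projective
    resolutions: they provide enough projectives, resolutions, pullbacks and pushouts
    inside [CA]. *)
Record resolving := Resolving {
  resolving_fg : forall A, CA A -> fgmod A;
  resolving_proj : forall P, fgproj P -> CA P;
  resolving_ext : forall K E Q (f : {linear K -> E}) (g : {linear E -> Q}),
    short_exact f g -> CA K -> CA Q -> CA E;
  resolving_ker : forall K P Q (f : {linear K -> P}) (g : {linear P -> Q}),
    short_exact f g -> fgproj P -> CA Q -> CA K
}.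
Hypothesis CAr : resolving.

Lemma conflation_mor_refl A B (xi : conflation CA A B) : conflation_mor id id xi xi.
Proof. by exists idfun. Qed.

Lemma yext_mor_refl n A B (xi : yext CA n A B) : yext_mor id id xi xi.
Proof.
elim: n A xi => [|n IHn] A /= xi; first exact: conflation_mor_refl.
by exists idfun; split; [exact: conflation_mor_refl|exact: IHn].
Qed.

Lemma conflation_mor_comp A B A' B' A'' B'' (a : A -> A') (b : B -> B')
    (a' : A' -> A'') (b' : B' -> B'') (xi : conflation CA A B)
    (xi' : conflation CA A' B') (xi'' : conflation CA A'' B'') :
  conflation_mor a b xi xi' -> conflation_mor a' b' xi' xi'' ->
  conflation_mor (a' \o a) (b' \o b) xi xi''.
Proof.
move=> [e [ei ep]] [e' [ei' ep']]; exists (e' \o e).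
by split=> x /=; rewrite ?ei ?ei' ?ep' ?ep.
Qed.

Lemma yext_mor_comp n A B A' B' A'' B'' (a : A -> A') (b : B -> B')
    (a' : A' -> A'') (b' : B' -> B'') (xi : yext CA n A B)
    (xi' : yext CA n A' B') (xi'' : yext CA n A'' B'') :
  yext_mor a b xi xi' -> yext_mor a' b' xi' xi'' ->
  yext_mor (a' \o a) (b' \o b) xi xi''.
Proof.
elim: n A A' A'' a a' xi xi' xi'' => [|n IHn] A A' A'' a a' xi xi' xi'' /=.
  exact: conflation_mor_comp.
move=> [k [m1 m2]] [k' [m1' m2']]; exists (k' \o k); split.
  exact: conflation_mor_comp m1 m1'.
exact: IHn m2 m2'.
Qed.

Lemma yext_ends n A B (xi : yext CA n A B) : CA A /\ CA B.
Proof.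
elim: n A xi => [|n IHn] A /=; first by case=> E f g _ [].
by case=> K [[E f g _ [_ _ CAA]] /IHn[_ CB]].
Qed.

(** The middle term is the fibre product, an extension of [A'] by [B], so it stays in
    [CA]. *)
Lemma conflation_pullback A B A' (a : {linear A' -> A}) (xi : conflation CA A B) :
  CA A' -> exists xi' : conflation CA A' B, conflation_mor a id xi' xi.
Proof.
case: xi => E f g fg [CB CE CAA] CA'; have [fi fgE gs] := fg.
have [h hE] := @copair_exists R _ _ _ g (-%R \o a).
have hs : surj h.
  by move=> z; have [x xE] := gs z; exists (x, 0); rewrite hE /= linear0 oppr0 addr0.
have [D [j jh]] := kernel_exists hs; have [ji jhE _] := jh.
have [|i iE] := @ses_lift _ _ _ _ j h _ (in1 E A' \o f) jh.
  move=> x; rewrite hE /= linear0 oppr0 addr0; apply/fgE; by exists x.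
have ip : short_exact i (pr2 E A' \o j).
  split=> [x y e|x|z].
  - by apply: fi; have := congr1 j e; rewrite !iE => -[].
  - split=> [/= x2|[y <-]]; last by rewrite /= iE.
    have : h (j x) = 0 by apply/jhE; exists x.
    rewrite hE /= x2 linear0 oppr0 addr0 => /fgE[y yE]; exists y; apply: ji.
    by rewrite iE /= yE; case: (j x) x2 => /= ? ? ->.
  have [x xE] := gs (a z).
  have /jhE[d dE] : h (x, z) = 0 by rewrite hE /= xE subrr.
  by exists d; rewrite /= dE.
have CD : CA D by exact: (resolving_ext CAr ip).
exists (Conflation ip (And3 CB CD CA')), (pr1 E A' \o j); split=> x /=.
  by rewrite iE.
have : h (j x) = 0 by apply/jhE; exists x.
by rewrite hE /= => /eqP; rewrite subr_eq0 => /eqP.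
Qed.

(** The middle term is the amalgamated sum, an extension of [A] by [B'], so it stays in
    [CA]. *)
Lemma conflation_pushout A B B' (b : {linear B -> B'}) (xi : conflation CA A B) :
  CA B' -> exists xi' : conflation CA A B', conflation_mor id b xi xi'.
Proof.
case: xi => E f g fg [CB CE CAA] CB'; have [fi fgE gs] := fg.
have [h hE] := @pair_exists R _ _ _ f (-%R \o b).
have hi : injective h by move=> x y; rewrite !hE => -[/fi].
have [Q [p hp]] := cokernel_exists hi; have [_ hpE ps] := hp.
have [|q qE] := @ses_factor _ _ _ _ h p _ (g \o pr1 E B') hp.
  by move=> x; rewrite hE /=; apply/fgE; exists x.
have iq : short_exact (p \o in2 E B') q.
  split=> [x y /eqP|x|z].
  - rewrite -subr_eq0 -linearB => /eqP/hpE[w]; rewrite hE /= => -[].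
    rewrite -[X in _ = X -> _](linear0 f) => /fi -> /eqP.
    by rewrite linear0 oppr0 eq_sym subr_eq0 => /eqP.
  - split=> [|[y <-]]; last by rewrite /= qE /= linear0.
    have [[x1 x2] <-] := ps x; rewrite qE /= => /fgE[y yE].
    exists (x2 + b y); apply/eqP; rewrite -subr_eq0 -linearB; apply/eqP/hpE.
    exists (- y); rewrite hE /= !linearN opprK /= yE; congr (_, _).
      by rewrite /= sub0r.
    by rewrite /= addrAC subrr add0r.
  have [x xE] := gs z; exists (p (x, 0)); by rewrite qE.
have CQ : CA Q by exact: (resolving_ext CAr iq).
exists (Conflation iq (And3 CB' CQ CAA)), (p \o in1 E B'); split=> x /=; last by rewrite qE.
apply/eqP; rewrite -subr_eq0 -linearB; apply/eqP/hpE; exists x.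
by rewrite hE; congr (_, _); rewrite /= ?subr0 ?sub0r.
Qed.

Lemma yext_pullback n A B A' (a : {linear A' -> A}) (xi : yext CA n A B) :
  CA A' -> exists xi' : yext CA n A' B, yext_mor a id xi' xi.
Proof.
case: n xi => [|n] /= xi; first exact: conflation_pullback.
case: xi => K [c eta] /(conflation_pullback a c)[c' c'c].
exists (existT _ K (c', eta)), idfun; split=> //; exact: yext_mor_refl.
Qed.

Lemma yext_pushout n A B B' (b : {linear B -> B'}) (xi : yext CA n A B) :
  CA B' -> exists xi' : yext CA n A B', yext_mor id b xi xi'.
Proof.
move=> CB'; elim: n A xi => [|n IHn] A /= xi; first exact: conflation_pushout.
case: xi => K [c eta]; have [eta' e] := IHn _ eta.
exists (existT _ K (c, eta')), idfun; split=> //; exact: conflation_mor_refl.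
Qed.

Lemma yext_equiv_cons n A K B (c : conflation CA A K) (eta eta' : yext CA n K B) :
  yext_equiv eta eta' ->
  @yext_equiv R CA n.+1 A B (existT _ K (c, eta)) (existT _ K (c, eta')).
Proof.
elim=> [x y xy|x|x y _ IH|x y z _ IH1 _ IH2].
- apply: rst_step; exists idfun; split=> //; exact: conflation_mor_refl.
- exact: rst_refl.
- exact: rst_sym.
- exact: rst_trans IH1 IH2.
Qed.

(** By induction on [n]: comparing the first step of a projective resolution of [A] with
    an extension of [A] by [B], and pulling back along the comparison map, replaces that
    extension by an equivalent one starting with a fixed conflation, and the induction
    hypothesis applies to the rest. For [n = 0] both extensions split. *)
Lemma ext1_equiv n A W B : syzygy n A W -> ext1_zero W B ->
  forall xi xi' : yext CA n A B, yext_equiv xi xi'.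
Proof.
move=> + WB; elim: n A => [|n IHn] A.
  move=> /= -> [E f g fg Cs] [E' f' g' fg' Cs']; apply: rst_step.
  have [r rE] := WB _ _ _ _ fg idfun; have [r' r'E] := WB _ _ _ _ fg' idfun.
  have [_ f'g'E _] := fg'; have [_ fgE _] := fg.
  have [|s sE] := @ses_factor _ _ _ _ f' g' _ (idfun \- (f' \o r')) fg'.
    by move=> x; rewrite /= r'E subrr.
  exists ((f' \o r) \+ (s \o g)); split=> x /=.
    rewrite rE; have -> : g (f x) = 0 by apply/fgE; exists x.
    by rewrite linear0 addr0.
  have g'f' y : g' (f' y) = 0 by apply/f'g'E; exists y.
  rewrite linearD /= g'f' add0r.
  have [_ _ /(_ (g x))[y <-]] := fg'.
  by rewrite sE linearB /= g'f' subr0.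
move=> [K [P [f [g [pP fg sy]]]]] xi xi'; have [CAA CB] := yext_ends xi.
have CK : CA K by exact: (resolving_ker CAr fg).
pose c := Conflation fg (And3 CK (resolving_proj CAr pP) CAA).
have lift (zeta : yext CA n.+1 A B) : exists eta : yext CA n K B,
    @yext_mor R CA n.+1 A B A B id id (existT _ K (c, eta)) zeta.
  case: zeta => K1 [[E1 f1 g1 fg1 Cs] eta].
  have [_ fg1E g1s] := fg1; have [_ fgE _] := fg.
  have [e eE] := pP.2 _ _ _ g g1s.
  have [|k kE] := @ses_lift _ _ _ _ f1 g1 _ (e \o f) fg1.
    by move=> x; rewrite /= eE; apply/fgE; exists x.
  have [eta' eta'E] := yext_pullback k eta CK.
  by exists eta', k; split=> //; exists e; split.
have [eta m] := lift xi; have [eta' m'] := lift xi'.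
apply: (rst_trans _ _ _ (existT _ K (c, eta))); first exact/rst_sym/rst_step.
apply: (rst_trans _ _ _ (existT _ K (c, eta'))); last exact: rst_step.
exact/yext_equiv_cons/IHn.
Qed.

Fixpoint proj_resolution n A W : yext CA n A W -> Prop :=
  match n with
  | 0 => fun xi => fgproj (cmid xi)
  | m.+1 => fun xi => fgproj (cmid (projT2 xi).1) /\ proj_resolution (projT2 xi).2
  end.

(** The map [w] extends along the last inclusion [W -> E_n] of the extension. For a
    projective resolution, the maps with this property are those of class zero in
    Ext^(n+1). *)
Fixpoint extends_last n A W X : yext CA n A W -> (W -> X) -> Prop :=
  match n with
  | 0 => fun xi w => exists v : {linear cmid xi -> X}, forall x, v (cinc xi x) = w x
  | m.+1 => fun xi w => extends_last (projT2 xi).2 w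
  end.

Lemma conflation_lift A W A' B (c : conflation CA A W) (xi : conflation CA A' B)
    (a : {linear A -> A'}) :
  fgproj (cmid c) -> exists u : {linear W -> B}, conflation_mor a u c xi.
Proof.
case: c xi => F i p ip Cs [E f g fg Cs'] /= [_ pF].
have [_ fgE gs] := fg; have [_ ipE _] := ip.
have [e eE] := pF _ _ g (a \o p) gs.
have [|u uE] := @ses_lift _ _ _ _ f g _ (e \o i) fg.
  move=> x; rewrite /= eE /=.
  by have -> : p (i x) = 0; [apply/ipE; exists x|rewrite linear0].
by exists u, e; split.
Qed.

Lemma yext_lift n A W A' B (res : yext CA n A W) (xi : yext CA n A' B)
    (a : {linear A -> A'}) :
  proj_resolution res -> exists u : {linear W -> B}, yext_mor a u res xi.
Proof.
elim: n A A' a res xi => [|n IHn] A A' a /= res xi; first exact: conflation_lift.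
case=> pF pr; have [k kE] := conflation_lift (projT2 xi).1 a pF.
by have [u uE] := IHn _ _ k _ (projT2 xi).2 pr; exists u, k.
Qed.

(** The difference of the two comparison maps, corrected by a lift of [t] applied to
    [j], maps into the kernel of [cprj xi]. *)
Lemma conflation_homotopy A W A' B P (c : conflation CA A W) (xi : conflation CA A' B)
    (a a' : A -> A') (u u' : W -> B) (j : {linear A -> P}) (t : {linear P -> A'}) :
  projective P -> (forall x, a x - a' x = t (j x)) ->
  conflation_mor a u c xi -> conflation_mor a' u' c xi ->
  exists v : {linear cmid c -> B}, forall x, v (cinc c x) = u x - u' x.
Proof.
case: c xi => F i p ip Cs [E f g fg Cs'] pP aa' [/= e [ei ep]] [/= e' [ei' ep']].
have [fi fgE gs] := fg; have [_ ipE _] := ip.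
have [t' t'E] := pP _ _ g t gs.
have [|v vE] := @ses_lift _ _ _ _ f g _ ((e \- e') \- (t' \o (j \o p))) fg.
  by move=> x; rewrite /= !linearB /= t'E ep ep' aa' subrr.
exists v => x; apply: fi; rewrite vE /=.
have -> : p (i x) = 0 by apply/ipE; exists x.
by rewrite !linear0 addr0 linearB ei ei'.
Qed.

(** Comparison maps out of a projective resolution are unique up to homotopy. The
    homotopy built at each step is the factorization through a projective which the
    induction hypothesis asks for. *)
Lemma yext_homotopy n A W A' B P (res : yext CA n A W) (xi : yext CA n A' B)
    (a a' : A -> A') (u u' : W -> B) (j : {linear A -> P}) (t : {linear P -> A'}) :
  proj_resolution res -> projective P -> (forall x, a x - a' x = t (j x)) ->
  yext_mor a u res xi -> yext_mor a' u' res xi ->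
  extends_last res (fun x => u x - u' x).
Proof.
elim: n A A' P a a' res xi j t => [|n IHn] A A' P a a' /= res xi j t.
  by move=> _; exact: conflation_homotopy.
move=> [pF pr] pP aa' [k [m1 m2]] [k' [m1' m2']].
have [v vE] := conflation_homotopy pP aa' m1 m1'.
by apply: (IHn _ _ _ k k' _ _ (cinc (projT2 res).1) v _ pF.2 _ m2 m2').
Qed.

Lemma extends_lastB n A W X (res : yext CA n A W) (w w' : W -> X) :
  extends_last res w -> extends_last res w' ->
  extends_last res (fun x => w x - w' x).
Proof.
elim: n A res => [|n IHn] A /= res; last exact: IHn.
by move=> [v vE] [v' v'E]; exists (v \- v') => x /=; rewrite vE v'E.
Qed.

Lemma extends_last_eq n A W X (res : yext CA n A W) (w w' : W -> X) :
  w =1 w' -> extends_last res w -> extends_last res w'.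
Proof.
move=> ww'; elim: n A res => [|n IHn] A /= res; last exact: IHn.
by move=> [v vE]; exists v => x; rewrite vE ww'.
Qed.

(** A comparison map from a projective resolution composes with morphisms of extensions,
    so its class, modulo the maps extending to the last projective, is an invariant of
    the Yoneda class. *)
Lemma yext_equiv_class n A W B (res : yext CA n A W) (xi xi' : yext CA n A B) :
  proj_resolution res -> yext_equiv xi xi' -> forall u u' : {linear W -> B},
  yext_mor id u res xi -> yext_mor id u' res xi' ->
  extends_last res (fun x => u x - u' x).
Proof.
move=> pr; have uniq (zeta : yext CA n A B) (u u' : {linear W -> B}) :
    yext_mor id u res zeta -> yext_mor id u' res zeta ->
    extends_last res (fun x => u x - u' x).
  apply: (@yext_homotopy _ _ _ _ _ 'rV[R]_0 _ _ _ _ _ _ \0 \0) => //.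
    exact: row_projective.
  by move=> x; rewrite subrr.
elim=> {xi xi'} [x y xy u u' mx my|x u u'|x y _ IH u u' mx my|x y z _ IH1 _ IH2 u u' mx mz].
- exact: (uniq y _ _ (yext_mor_comp mx xy)).
- exact: uniq.
- have e0 : extends_last res (fun x => u x - u x) by exact: (uniq _ _ _ mx mx).
  have e1 := IH _ _ my mx; have := extends_lastB e0 e1.
  by apply: extends_last_eq => w /=; rewrite subrr sub0r opprB.
have [v vE] := yext_lift y idfun pr.
have e0 : extends_last res (fun x => v x - v x) by exact: (uniq _ _ _ vE vE).
have e1 := IH1 _ _ mx vE; have e2 := IH2 _ _ vE mz.
have := extends_lastB e1 (extends_lastB e0 e2).
by apply: extends_last_eq => w; rewrite subrr sub0r opprK addrA subrK.
Qed.

(** The map [u] is the comparison map of the pushout of the resolution along [u], and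
    the zero map that of the pushout along zero. If Ext vanishes, these two
    extensions are equivalent, so [u] has class zero. *)
Lemma Ext_zero_extends n A W B (res : yext CA n A W) :
  CA B -> proj_resolution res -> Ext_zero CA n.+1 A B ->
  forall u : {linear W -> B}, extends_last res u.
Proof.
move=> CB pr E0 u.
have [xi xiE] := yext_pushout u res CB.
have [xi' xi'E] := yext_pushout (\0 : {linear W -> B}) res CB.
have := yext_equiv_class pr (E0 xi xi') xiE xi'E.
by apply: extends_last_eq => x; rewrite /= subr0.
Qed.

Lemma syzygy_res n A W : syzygy n A W -> CA A ->
  exists W' (res : yext CA n A W'), proj_resolution res /\
    forall B, (forall u : {linear W' -> B}, extends_last res u) -> ext1_zero W B.
Proof.
elim: n A => [|n IHn] A /= => [<- CAA|[K [P [f [g [pP fg sy]]]]] CAA].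
  have [P [K [f [g [pP fg]]]]] := cover_exists (resolving_fg CAr CAA).
  have CK : CA K by exact: (resolving_ker CAr fg).
  exists K, (Conflation fg (And3 CK (resolving_proj CAr pP) CAA)).
  split=> // B ex; exact: ext1_pres pP.2 fg ex.
have CK : CA K by exact: (resolving_ker CAr fg).
have [W' [res [pr ex]]] := IHn _ sy CK.
exists W', (existT _ K (Conflation fg (And3 CK (resolving_proj CAr pP) CAA), res)).
by split.
Qed.

(** The right-hand side involves neither [CA] nor, on the left, the choice of [W]. So
    this both compares Ext over different subcategories and shows independence of the
    resolution. *)
Theorem Ext_zeroP n A W B : CA A -> CA B -> syzygy n A W ->
  Ext_zero CA n.+1 A B <-> ext1_zero W B.
Proof.
move=> CAA CB sy; split=> [E0|WB]; last exact: ext1_equiv sy WB.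
have [W' [res [pr ex]]] := syzygy_res sy CAA.
exact/ex/Ext_zero_extends.
Qed.

End Yoneda.

(** * The horseshoe lemma and dimension shifting *)

Section Horseshoe.
Variable R : nzRingType.
Implicit Types A B C E F I K M N Q U V X P W KA KC KN PA PC : lmodType R.

Lemma ses0 K E Q (f : {linear K -> E}) (g : {linear E -> Q}) x :
  short_exact f g -> g (f x) = 0.
Proof. by case=> _ fgE _; apply/fgE; exists x. Qed.

Lemma syzygy_trans m n A V W : syzygy m A V -> syzygy n V W -> syzygy (m + n) A W.
Proof.
elim: m A => [|m IHm] A /= => [->|[K [P [f [g [pP fg sy]]]]] sy'] //.
by exists K, P, f, g; split=> //; exact: IHm.
Qed.

Lemma syzygy_split m n A W : syzygy (m + n) A W -> exists2 V, syzygy m A V & syzygy n V W.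
Proof.
elim: m A => [|m IHm] A /= => [sy|[K [P [f [g [pP fg /IHm[V sy sy']]]]]]].
  by exists A.
by exists V => //; exists K, P, f, g.
Qed.

Lemma syzygy_resolving (CA : subcat R) n A W : resolving CA -> CA A -> syzygy n A W -> CA W.
Proof.
move=> CAr; elim: n A => [|n IHn] A CAA /=; first by move=> <-.
move=> [K [P [f [g [pP fg]]]]]; apply: IHn; exact: (resolving_ker CAr fg pP CAA).
Qed.

Lemma syzygy_exists (CA : subcat R) n A : resolving CA -> CA A -> exists W, syzygy n A W.
Proof.
move=> CAr; elim: n A => [|n IHn] A CAA /=; first by exists A.
have [P [K [f [g [pP fg]]]]] := cover_exists (resolving_fg CAr CAA).
have [W sy] := IHn _ (resolving_ker CAr fg pP CAA).
by exists W, K, P, f, g.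
Qed.

Lemma projective_ses_split K E P (f : {linear K -> E}) (g : {linear E -> P}) :
  projective P -> short_exact f g -> exists r : {linear E -> K}, forall x, r (f x) = x.
Proof.
move=> pP fg; have [fi _ gs] := fg.
have [s sE] := pP _ _ g idfun gs.
have [|r rE] := @ses_lift _ _ _ _ f g _ (idfun \- (s \o g)) fg.
  by move=> x; rewrite linearB /= sE subrr.
by exists r => x; apply: fi; rewrite rE /= (ses0 _ fg) linear0 subr0.
Qed.

Lemma ext1_proj P B : projective P -> ext1_zero P B.
Proof.
move=> pP K E f g fg u; have [r rE] := projective_ses_split pP fg.
by exists (u \o r) => x; rewrite /= rE.
Qed.

Lemma ext1_retract A B B' (s : {linear B -> B'}) (r : {linear B' -> B}) :
  cancel s r -> ext1_zero A B' -> ext1_zero A B.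
Proof.
move=> srK AB' K E f g fg u; have [v vE] := AB' _ _ _ _ fg (s \o u).
by exists (r \o v) => x /=; rewrite vE /= srK.
Qed.

(** The presentation of [N] is built from a lift of [c'] to [N]; the two commutation
    clauses record that everything is compatible with the split sequence
    [PA -> PA * PC -> PC]. *)
Lemma horseshoe A N C KA PA KC PC (i : {linear A -> N}) (p : {linear N -> C})
    (a : {linear KA -> PA}) (a' : {linear PA -> A})
    (c : {linear KC -> PC}) (c' : {linear PC -> C}) :
  short_exact i p -> short_exact a a' -> short_exact c c' -> projective PC ->
  exists KN (n : {linear KN -> (PA * PC)%type}) (n' : {linear (PA * PC)%type -> N})
    (s : {linear KA -> KN}) (t : {linear KN -> KC}),
    [/\ short_exact n n', short_exact s t,
        (forall x, n (s x) = in1 PA PC (a x)) /\ (forall x, c (t x) = (n x).2)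
      & (forall x, n' (in1 PA PC x) = i (a' x)) /\ (forall x, p (n' x) = c' x.2)].
Proof.
move=> ip aa' cc' pPC; have [ii ipE ps] := ip; have [ai aE a's] := aa'.
have [ci cE c's] := cc'.
have [l lE] := pPC _ _ p c' ps.
have [n' n'E] := copair_exists (i \o a') l.
have pn' x : p (n' x) = c' x.2 by rewrite n'E linearD /= (ses0 _ ip) add0r lE.
have n's : surj n'.
  move=> x; have [z zE] := c's (p x).
  have /ipE[w wE] : p (x - l z) = 0 by rewrite linearB /= lE zE subrr.
  by have [y yE] := a's w; exists (y, z); rewrite n'E /= yE wE subrK.
have [KN [n nn']] := kernel_exists n's; have [ni nE _] := nn'.
have n'1 x : n' (in1 PA PC x) = i (a' x) by rewrite n'E /= linear0 addr0.
have [|s sE] := @ses_lift _ _ _ _ n n' _ (in1 PA PC \o a) nn'.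
  by move=> x; rewrite /= n'1 (ses0 _ aa') linear0.
have [|t tE] := @ses_lift _ _ _ _ c c' _ (pr2 PA PC \o n) cc'.
  by move=> x; rewrite /= -pn' (ses0 _ nn') linear0.
exists KN, n, n', s, t; split=> //; split=> [x y e|x|z].
- by apply: ai; have := congr1 n e; rewrite !sE => -[].
- split=> [tx0|[y <-]].
    have n2 : (n x).2 = 0 by have := tE x; rewrite tx0 linear0.
    have nx : n x = in1 PA PC (n x).1.
      by rewrite -[LHS]in1Din2 n2 linear0 addr0.
    have : n' (n x) = 0 by exact: ses0 nn'.
    rewrite nx n'1 -[X in _ = X -> _](linear0 i) => /ii/aE[y yE].
    by exists y; apply: ni; rewrite sE /= yE nx.
  by apply: ci; rewrite tE /= sE linear0.
have /ipE[w wE] : p (l (c z)) = 0 by rewrite lE (ses0 _ cc').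
have [y yE] := a's w.
have /nE[x xE] : n' (- y, c z) = 0.
  by rewrite n'E /= !linearN /= yE wE addNr.
by exists x; apply: ci; rewrite tE /= xE.
Qed.

(** Exactness of Ext^1(C, B) -> Ext^1(N, B) -> Ext^1(A, B). *)
Lemma ext1_mid A N C B (i : {linear A -> N}) (p : {linear N -> C}) :
  short_exact i p -> fgmod A -> fgmod C -> ext1_zero A B -> ext1_zero C B -> ext1_zero N B.
Proof.
move=> ip fA fC AB CB.
have [PA [KA [a [a' [[_ pPA] aa']]]]] := cover_exists fA.
have [PC [KC [c [c' [[_ pPC] cc']]]]] := cover_exists fC.
have [KN [n [n' [s [t [nn' st [ns ct] _]]]]]] := horseshoe ip aa' cc' pPC.
apply: (ext1_pres (prod_projective pPA pPC) nn') => u.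
have [v vE] := AB _ _ _ _ aa' (u \o s).
have [|w wE] := @ses_factor _ _ _ _ s t _ (u \- (v \o (pr1 PA PC \o n))) st.
  by move=> x; rewrite /= ns /= vE /= subrr.
have [z zE] := CB _ _ _ _ cc' w.
have [h hE] := copair_exists v z; exists h => x.
by rewrite hE -ct zE wE /= addrC subrK.
Qed.

(** Exactness of Hom(N, B) -> Hom(A, B) -> Ext^1(C, B) -> Ext^1(N, B). *)
Lemma ext1_right A N C B (i : {linear A -> N}) (p : {linear N -> C}) :
  short_exact i p -> fgmod A -> fgmod C -> ext1_zero N B ->
  (forall u : {linear A -> B}, exists v : {linear N -> B}, forall x, v (i x) = u x) ->
  ext1_zero C B.
Proof.
move=> ip fA fC NB ex.
have [PA [KA [a [a' [[_ pPA] aa']]]]] := cover_exists fA.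
have [PC [KC [c [c' [[_ pPC] cc']]]]] := cover_exists fC.
have [KN [n [n' [s [t [nn' st [ns ct] [n'1 pn']]]]]]] := horseshoe ip aa' cc' pPC.
apply: (ext1_pres pPC cc') => u.
have [v vE] := NB _ _ _ _ nn' (u \o t).
have [|w wE] := @ses_factor _ _ _ _ a a' _ (v \o in1 PA PC) aa'.
  by move=> x; rewrite /= -[inl_fun _ _]ns vE /= (ses0 _ st) linear0.
have [z zE] := ex w.
exists ((v \- (z \o n')) \o in2 PA PC) => x.
have [_ _ ts] := st; have [y yE] := ts x.
have e : forall q, v q - z (n' q) = (v \- (z \o n')) (in2 PA PC q.2).
  move=> q; rewrite -{1 2}(in1Din2 q) !linearD /= n'1 zE wE.
  by rewrite addrACA /= subrr add0r.
rewrite -yE ct; transitivity (v (n y) - z (n' (n y))); first by rewrite e.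
by rewrite vE (ses0 _ nn') linear0 subr0.
Qed.

(** Exactness of Ext^1(N, B) -> Ext^1(A, B) -> Ext^2(C, B), with Ext^2(C, B) computed as
    Ext^1 of the syzygy [KC]. *)
Lemma ext1_left A N C B KC PC (i : {linear A -> N}) (p : {linear N -> C})
    (c : {linear KC -> PC}) (c' : {linear PC -> C}) :
  short_exact i p -> fgmod A -> projective PC -> short_exact c c' ->
  ext1_zero N B -> ext1_zero KC B -> ext1_zero A B.
Proof.
move=> ip fA pPC cc' NB KB.
have [PA [KA [a [a' [[_ pPA] aa']]]]] := cover_exists fA.
have [KN [n [n' [s [t [nn' st [ns ct] _]]]]]] := horseshoe ip aa' cc' pPC.
apply: (ext1_pres pPA aa') => u.
have [v vE] := KB _ _ _ _ st u.
have [w wE] := NB _ _ _ _ nn' v.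
by exists (w \o in1 PA PC) => x; rewrite /= -[inl_fun _ _]ns wE vE.
Qed.

(** Exactness of Hom(W, E) -> Hom(W, C) -> Ext^1(W, B). *)
Lemma ext1_lift W B E C (i : {linear B -> E}) (p : {linear E -> C}) :
  short_exact i p -> fgmod W -> ext1_zero W B ->
  forall u : {linear W -> C}, exists v : {linear W -> E}, forall x, p (v x) = u x.
Proof.
move=> ip fW WB u; have [ii ipE ps] := ip.
have [P [K [f [g [[_ pP] fg]]]]] := cover_exists fW.
have [e eE] := pP _ _ p (u \o g) ps.
have [|k kE] := @ses_lift _ _ _ _ i p _ (e \o f) ip.
  by move=> x; rewrite /= eE /= (ses0 _ fg) linear0.
have [w wE] := WB _ _ _ _ fg k.
have [|v vE] := @ses_factor _ _ _ _ f g _ (e \- (i \o w)) fg.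
  by move=> x; rewrite /= wE kE subrr.
exists v => x; have [_ _ gs] := fg; have [y <-] := gs x.
by rewrite vE linearB /= (ses0 _ ip) subr0 eE.
Qed.

(** From Ext^1(W, P) -> Ext^1(W, C) -> Ext^2(W, B), with Ext^2(W, B) = Ext^1(W', B). *)
Lemma ext1_shift_up W W' F B P C (i : {linear B -> P}) (p : {linear P -> C})
    (f : {linear W' -> F}) (g : {linear F -> W}) :
  short_exact i p -> short_exact f g -> projective F -> fgmod W' ->
  ext1_zero W' B -> ext1_zero W P -> ext1_zero W C.
Proof.
move=> ip fg pF fW' W'B WP; apply: (ext1_pres pF fg) => u.
have [v vE] := ext1_lift ip fW' W'B u.
have [w wE] := WP _ _ _ _ fg v.
by exists (p \o w) => x; rewrite /= wE vE.
Qed.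

(** From Ext^1(W, C) -> Ext^2(W, B) -> Ext^2(W, P), with Ext^2(W, -) = Ext^1(W', -). *)
Lemma ext1_shift_down W W' F B P C (i : {linear B -> P}) (p : {linear P -> C})
    (f : {linear W' -> F}) (g : {linear F -> W}) :
  short_exact i p -> short_exact f g -> projective F -> fgmod W' ->
  ext1_zero W C -> ext1_zero W' P -> ext1_zero W' B.
Proof.
move=> ip fg pF fW' WC W'P; have [ii ipE ps] := ip.
have [F' [W'' [f' [g' [[_ pF'] fg']]]]] := cover_exists fW'.
apply: (ext1_pres pF' fg') => u.
have [e eE] := W'P _ _ _ _ fg' (i \o u).
have [|ub ubE] := @ses_factor _ _ _ _ f' g' _ (p \o e) fg'.
  by move=> x; rewrite /= eE /= (ses0 _ ip).
have [v vE] := WC _ _ _ _ fg ub.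
have [w wE] := pF _ _ p v ps.
have [|r rE] := @ses_lift _ _ _ _ i p _ (e \- (w \o (f \o g'))) ip.
  by move=> x; rewrite linearB /= wE vE ubE subrr.
exists r => x; apply: ii.
by rewrite rE /= (ses0 _ fg') !linear0 addr0 eE.
Qed.
End Horseshoe.

(** * Vanishing of Ext over a Noetherian ring *)

Section LongExactSequences.
Variable R : nzRingType.
Implicit Types A B C E F I K M N Q U V X P W KA KC KN PA PC : lmodType R.

Definition noetherian := forall K E Q (f : {linear K -> E}) (g : {linear E -> Q}),
  short_exact f g -> fgmod E -> fgmod K.
Hypothesis noeth : noetherian.

Lemma fgmod_resolving : resolving (@fgmod R).
Proof.
split=> // [P []//|K E Q f g fg|K P Q f g fg [fP _] _].
  exact: fgmod_ext fg.
exact: noeth fg fP.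
Qed.

(** Vanishing of Ext^(n+1)(A, B): the index is shifted so that there is no case of
    degree zero. *)
Definition ext_zero n A B := forall W, syzygy n A W -> ext1_zero W B.

Lemma ext_zero_indep n A W B :
  fgmod A -> fgmod B -> syzygy n A W -> ext_zero n A B <-> ext1_zero W B.
Proof.
move=> fA fB sy; split=> [|WB W' sy']; first exact.
apply/(Ext_zeroP fgmod_resolving fA fB sy').
by apply/(Ext_zeroP fgmod_resolving fA fB sy).
Qed.

Lemma Ext_zero_resolving (CA : subcat R) n A B : resolving CA -> CA A -> CA B ->
  Ext_zero CA n.+1 A B <-> ext_zero n A B.
Proof.
move=> CAr CAA CB; have [W sy] := syzygy_exists n CAr CAA.
rewrite (Ext_zeroP CAr CAA CB sy) (ext_zero_indep _ _ sy) //; exact: (resolving_fg CAr).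
Qed.

Lemma ext_zero0 A B : ext_zero 0 A B <-> ext1_zero A B.
Proof. by split=> [|AB W <-] //; apply. Qed.

Lemma ext_zeroS n A B K P (f : {linear K -> P}) (g : {linear P -> A}) :
  fgmod A -> fgmod B -> fgproj P -> short_exact f g -> ext_zero n.+1 A B <-> ext_zero n K B.
Proof.
move=> fA fB pP fg; split=> [e W sy|e].
  by apply: e; exists K, P, f, g.
have fK : fgmod K by exact: noeth fg pP.1.
have [W sy] := syzygy_exists n fgmod_resolving fK.
have sy' : syzygy n.+1 A W by exists K, P, f, g.
by apply/(ext_zero_indep fA fB sy'); exact: e.
Qed.

Lemma ext_syzygy m n A W B :
  fgmod A -> fgmod B -> syzygy m A W -> ext_zero (m + n) A B <-> ext_zero n W B.
Proof.
move=> fA fB; elim: m A fA => [|m IHm] A fA /=; first by move=> ->.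
move=> [K [P [f [g [pP fg sy]]]]].
rewrite -(IHm K (noeth fg pP.1) sy); exact: (ext_zeroS _ fA fB pP fg).
Qed.

Lemma ext_proj n P B : fgproj P -> ext_zero n P B.
Proof.
elim: n P => [|n IHn] P pP; first by apply/ext_zero0/ext1_proj/pP.2.
move=> W /= [K [Q [f [g [pQ fg sy]]]]]; apply: IHn sy.
have [r rf] := projective_ses_split pP.2 fg.
split; first exact: noeth fg pQ.1.
move=> E X e h es; have [h' h'E] := pQ.2 _ _ e (h \o r) es.
by exists (h' \o f) => x; rewrite /= h'E /= rf.
Qed.

Lemma ext_retract n A B B' (s : {linear B -> B'}) (r : {linear B' -> B}) :
  cancel s r -> ext_zero n A B' -> ext_zero n A B.
Proof. by move=> srK AB' W sy; apply: ext1_retract srK (AB' _ sy). Qed.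

(** Exactness of Ext^(n+1)(C, B) -> Ext^(n+1)(N, B) -> Ext^(n+1)(A, B). Here and in the
    next two lemmas the horseshoe lemma reduces the degree by one. *)
Lemma ext_mid n A N C B (i : {linear A -> N}) (p : {linear N -> C}) :
  short_exact i p -> fgmod A -> fgmod C -> fgmod B ->
  ext_zero n A B -> ext_zero n C B -> ext_zero n N B.
Proof.
elim: n A N C i p => [|n IHn] A N C i p ip fA fC fB; have fN := fgmod_ext ip fA fC.
  by move=> /ext_zero0 ? /ext_zero0 ?; apply/ext_zero0; exact: ext1_mid ip _ _ _ _.
have [PA [KA [a [a' [pPA aa']]]]] := cover_exists fA.
have [PC [KC [c [c' [pPC cc']]]]] := cover_exists fC.
have [KN [q [q' [s [t [qq' st _ _]]]]]] := horseshoe ip aa' cc' pPC.2.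
move=> /(ext_zeroS _ fA fB pPA aa') e1 /(ext_zeroS _ fC fB pPC cc') e2.
apply/(ext_zeroS _ fN fB (fgproj_prod pPA pPC) qq').
apply: IHn st _ _ _ e1 e2 => //; [exact: noeth aa' pPA.1|exact: noeth cc' pPC.1].
Qed.

(** Exactness of Ext^(n+1)(A, B) -> Ext^(n+2)(C, B) -> Ext^(n+2)(N, B). *)
Lemma ext_right n A N C B (i : {linear A -> N}) (p : {linear N -> C}) :
  short_exact i p -> fgmod A -> fgmod C -> fgmod B ->
  ext_zero n.+1 N B -> ext_zero n A B -> ext_zero n.+1 C B.
Proof.
elim: n A N C i p => [|n IHn] A N C i p ip fA fC fB; have fN := fgmod_ext ip fA fC;
have [PA [KA [a [a' [pPA aa']]]]] := cover_exists fA;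
have [PC [KC [c [c' [pPC cc']]]]] := cover_exists fC;
have [KN [q [q' [s [t [qq' st [qs _] _]]]]]] := horseshoe ip aa' cc' pPC.2;
have fKA := noeth aa' pPA.1; have fKC := noeth cc' pPC.1;
move=> /(ext_zeroS _ fN fB (fgproj_prod pPA pPC) qq') e1.
  move=> /ext_zero0 AB; apply/(ext_zeroS _ fC fB pPC cc')/ext_zero0.
  apply: ext1_right st _ _ _ _ => //; first exact/ext_zero0.
  move=> u; have [v vE] := AB _ _ _ _ aa' u.
  by exists (v \o (pr1 PA PC \o q)) => x; rewrite /= qs /= vE.
move=> /(ext_zeroS _ fA fB pPA aa') e2; apply/(ext_zeroS _ fC fB pPC cc').
exact: IHn st _ _ _ e1 e2.
Qed.

(** Exactness of Ext^(n+1)(N, B) -> Ext^(n+1)(A, B) -> Ext^(n+2)(C, B). *)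
Lemma ext_left n A N C B (i : {linear A -> N}) (p : {linear N -> C}) :
  short_exact i p -> fgmod A -> fgmod C -> fgmod B ->
  ext_zero n N B -> ext_zero n.+1 C B -> ext_zero n A B.
Proof.
elim: n A N C i p => [|n IHn] A N C i p ip fA fC fB; have fN := fgmod_ext ip fA fC;
have [PC [KC [c [c' [pPC cc']]]]] := cover_exists fC.
  move=> /ext_zero0 NB /(ext_zeroS _ fC fB pPC cc')/ext_zero0 CB; apply/ext_zero0.
  exact: ext1_left ip _ pPC.2 cc' NB CB.
have [PA [KA [a [a' [pPA aa']]]]] := cover_exists fA.
have [KN [q [q' [s [t [qq' st [qs _] _]]]]]] := horseshoe ip aa' cc' pPC.2.
have fKA := noeth aa' pPA.1; have fKC := noeth cc' pPC.1.
move=> /(ext_zeroS _ fN fB (fgproj_prod pPA pPC) qq') e1.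
move=> /(ext_zeroS _ fC fB pPC cc') e2; apply/(ext_zeroS _ fA fB pPA aa').
exact: IHn st _ _ _ e1 e2.
Qed.

Lemma ext_shift n A B P C (i : {linear B -> P}) (p : {linear P -> C}) :
  short_exact i p -> fgmod A -> (forall k, ext_zero k A P) -> fgmod B -> fgmod P ->
  ext_zero n.+1 A B <-> ext_zero n A C.
Proof.
move=> ip fA AP fB fP.
have [W sy] := syzygy_exists n fgmod_resolving fA.
have fW := syzygy_resolving fgmod_resolving fA sy.
have [F [W' [f [g [pF fg]]]]] := cover_exists fW.
have fW' := noeth fg pF.1.
have sy1 : syzygy n.+1 A W'.
  rewrite -addn1; apply: syzygy_trans sy _; by exists W', F, f, g.
have fC : fgmod C by have [_ _ ps] := ip; exact: fgmod_surj ps fP.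
rewrite (ext_zero_indep fA fB sy1) (ext_zero_indep fA fC sy); split=> e.
  apply: ext1_shift_up ip fg pF.2 fW' e _; exact: (AP n).
apply: ext1_shift_down ip fg pF.2 fW' e _; exact: (AP n.+1).
Qed.

(** Ext^(n+1)(A, B) = 0 when [B] has injective dimension at most [n]: each cosyzygy of
    [B] removes one syzygy of [A], until the second variable is injective. *)
Lemma ext1_injdim n A W B : fgmod A -> injdim_le n B -> syzygy n A W -> ext1_zero W B.
Proof.
have inj W' I : fg_injective I -> fgmod W' -> ext1_zero W' I.
  move=> [fI injI] fW'; have [P [K [f [g [[fP pP] fg]]]]] := cover_exists fW'.
  apply: (ext1_pres pP fg) => u; have [fi _ _] := fg.
  by have [v vE] := injI _ _ f u (noeth fg fP) fP fi; exists v.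
elim: n A B W => [|n IHn] A B W fA /=; first by move=> iB <-; exact: inj.
move=> [I [C [i [p [iI ip dC]]]]] sy.
have : syzygy (n + 1) A W by rewrite addn1.
case/syzygy_split=> V syV [K [F [f [g [pF fg /= e]]]]]; subst K.
have fV := syzygy_resolving fgmod_resolving fA syV.
have fW : fgmod W by exact: noeth fg pF.1.
apply: ext1_shift_down ip fg pF.2 fW _ (inj _ _ iI fW).
exact: IHn fA dC syV.
Qed.

End LongExactSequences.

(** * Gorenstein projectives and cluster tilting *)

Section GorensteinProjectives.
Variable R : nzRingType.
Implicit Types A B C E F I K M N Q U V X Y Z P W : lmodType R.
Hypothesis noeth : noetherian R.

Let RR : lmodType R := R^o.

Lemma fgmod_regular : fgmod RR.
Proof.
exists [:: (1 : R^o)] => x; exists (fun=> x).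
by rewrite big_ord1 /= [RHS]mulr1.
Qed.

Definition gorproj A := fgmod A /\ forall n, ext_zero n A RR.

Lemma gorprojP A : Gorenstein_projective A <-> gorproj A.
Proof.
have e n : fgmod A -> Ext_zero (@fgmod R) n.+1 A RR <-> ext_zero n A RR.
  move=> fA; exact: (Ext_zero_resolving noeth n (fgmod_resolving noeth) fA fgmod_regular).
split=> -[fA h]; split=> //; first by move=> n; apply/e => //; exact: h.
by move=> [//|n] _; apply/e.
Qed.

Lemma gp_resolving : resolving gorproj.
Proof.
split=> [A []//|P pP|K E Q f g fg [fK eK] [fQ eQ]|K P Q f g fg pP [fQ eQ]].
- by split=> [|n]; [exact: pP.1|exact: ext_proj].
- split=> [|n]; first exact: fgmod_ext fg fK fQ.
  exact: (ext_mid noeth fg fK fQ fgmod_regular).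
- split=> [|n]; first exact: noeth fg pP.1.
  by apply/(ext_zeroS noeth n fQ fgmod_regular pP fg).
Qed.

Lemma gp_ext_proj n A P : gorproj A -> fgproj P -> ext_zero n A P.
Proof.
move=> [_ eA] /fgproj_retract[m [i [r ri]]]; apply: (ext_retract ri) => W sy K E f g fg u.
have c_lin (j : 'I_m) : exists c : {linear 'rV[R]_m -> RR}, forall v, c v = v 0 j.
  have [|c cE] := @lin_exists R 'rV[R]_m RR (fun v => v 0 j); last by exists c.
  by move=> a x y; rewrite !mxE.
have [c cE] := choice_fun c_lin.
have [v vE] := choice_fun (fun j => eA _ _ sy _ _ _ _ fg (c j \o u)).
have [|w wE] := @lin_exists R E 'rV[R]_m (fun x => \row_j v j x).
  by move=> a x y; apply/rowP => j; rewrite !mxE linearP.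
by exists w => x; apply/rowP => j; rewrite wE mxE vE /= cE.
Qed.

(** As Ext^1(N, R) = 0, the group Ext^1(C, R) is the cokernel of Hom(N, R) -> Hom(A, R). *)
Lemma gp_coker A N C (i : {linear A -> N}) (p : {linear N -> C}) :
  short_exact i p -> gorproj A -> gorproj N ->
  (forall u : {linear A -> RR}, exists v : {linear N -> RR}, forall x, v (i x) = u x) ->
  gorproj C.
Proof.
move=> ip [fA eA] [fN eN] ex.
have fC : fgmod C by have [_ _ ps] := ip; exact: fgmod_surj ps fN.
split=> // -[|n]; last exact: (ext_right noeth ip fA fC fgmod_regular (eN _) (eA _)).
by apply/ext_zero0/(ext1_right ip fA fC) => //; exact/ext_zero0.
Qed.

(** Projectives have no Ext from Gorenstein projectives, so Ext^(n+1)(A, Z) is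
    Ext^(n+2) from [A] to a syzygy of [Z]. *)
Lemma gp_shift m n A Z W : gorproj A -> fgmod Z -> syzygy m Z W ->
  ext_zero (n + m) A W <-> ext_zero n A Z.
Proof.
move=> gA; elim: m n Z => [|m IHm] n Z fZ /=; first by rewrite addn0 => ->.
move=> [K [P [f [g [pP fg sy]]]]].
have fK : fgmod K by exact: noeth fg pP.1.
rewrite -addSnnS (IHm _ _ fK sy).
by apply: (ext_shift noeth n fg gA.1 _ fK pP.1) => k; exact: gp_ext_proj.
Qed.

Lemma ext_prod n X A B : ext_zero n X A -> ext_zero n X B -> ext_zero n X (A * B)%type.
Proof.
move=> eA eB W sy K E f g fg u.
have [v vE] := eA _ sy _ _ _ _ fg (pr1 A B \o u).
have [w wE] := eB _ sy _ _ _ _ fg (pr2 A B \o u).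
have [h hE] := pair_exists v w; exists h => x.
by rewrite hE vE wE /=; case: (u x).
Qed.

(** A left approximation in the category modulo projectives, where taking syzygies is
    functorial. The target [X] may lie outside [C], as only maps into [C] are tested. *)
Definition stable_left_approx (C : subcat R) B X (f : {linear B -> X}) :=
  forall N, C N -> forall g : {linear B -> N},
    exists (h : {linear X -> N}) P (a : {linear B -> P}) (b : {linear P -> N}),
      fgproj P /\ forall x, g x = h (f x) + b (a x).

Definition stable_right_approx (C : subcat R) X B (f : {linear X -> B}) :=
  forall N, C N -> forall g : {linear N -> B},
    exists (h : {linear N -> X}) P (a : {linear N -> P}) (b : {linear P -> B}),
      fgproj P /\ forall x, g x = f (h x) + b (a x).

Definition syzygy_class m (C : subcat R) : subcat R := fun N => exists2 N', C N' & syzygy m N' N.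

(** On Gorenstein projectives taking syzygies is fully faithful modulo projectives: a map
    between syzygies extends to the projectives above them, because Ext^1(B, P) = 0,
    and so comes from a map out of [B]. *)
Lemma stable_left_syzygy m B A X V (C : subcat R) (f : {linear B -> X}) :
  gorproj B -> syzygy m B A -> syzygy m X V -> stable_left_approx C f ->
  exists f' : {linear A -> V}, stable_left_approx (syzygy_class m C) f'.
Proof.
elim: m B X C f => [|m IHm] B X C f gB /=.
  by move=> <- <- st; exists f => N [N' CN <-]; exact: st.
move=> [B1 [PB [i [p [pPB ip syB]]]]] [X1 [PX [i' [p' [pPX ip' syX]]]]] st.
have gB1 : gorproj B1 by exact: (resolving_ker gp_resolving ip pPB gB).
have [ii ipE ps] := ip; have [ii' ipE' ps'] := ip'.
have [ft ftE] := pPB.2 _ _ p' (f \o p) ps'.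
have [|f1 f1E] := @ses_lift _ _ _ _ i' p' _ (ft \o i) ip'.
  by move=> x; rewrite /= ftE /= (ses0 _ ip) linear0.
(* It suffices to treat one syzygy, with the first syzygies of [C] as the new class. *)
suff st1 : stable_left_approx (syzygy_class 1 C) f1.
  have [f' f'P] := IHm _ _ _ _ gB1 syB syX st1; exists f' => N [N' CN'].
  move=> [K [P [j [q [pP jq sy]]]]]; apply: f'P; exists K => //; exists N' => //.
  by exists K, P, j, q.
move=> N [N' CN' [K [Q [j [q [pQ jq /= e]]]]]] g; subst K.
have [ji jqE qs] := jq.
have [e eE] := (ext_zero0 _ _).1 (gp_ext_proj gB pQ) _ _ _ _ ip (j \o g).
have [|g' g'E] := @ses_factor _ _ _ _ i p _ (q \o e) ip.
  by move=> x; rewrite /= eE /= (ses0 _ jq).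
have [h [P [a [b [pP hab]]]]] := st _ CN' g'.
have [hQ hQE] := pPX.2 _ _ q (h \o p') qs.
have [bQ bQE] := pP.2 _ _ q b qs.
have [|h1 h1E] := @ses_lift _ _ _ _ j q _ (hQ \o i') jq.
  by move=> x; rewrite /= hQE /= (ses0 _ ip') linear0.
(* [e] and [hQ \o ft \+ bQ \o a \o p] induce the same map on [B], so their difference
   maps into [N]; on [B1] it is [g \- h1 \o f1]. *)
have [|c cE] := @ses_lift _ _ _ _ j q _ ((e \- (hQ \o ft)) \- (bQ \o (a \o p))) jq.
  move=> x; rewrite /= !linearB /= hQE bQE /= ftE -[q (e x)]g'E hab /=.
  by rewrite addrAC addrK subrr.
exists h1, PB, i, c; split=> // x; apply: ji.
rewrite linearD h1E cE /= f1E eE /= (ses0 _ ip).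
by rewrite !linear0 addr0 addrC subrK.
Qed.

(** The dual of [stable_left_syzygy]; the maps to be extended start now at syzygies of
    objects of [C], which therefore have to be Gorenstein projective. *)
Lemma stable_right_syzygy m B A X V (C : subcat R) (f : {linear X -> B}) :
  (forall N, C N -> gorproj N) -> syzygy m B A -> syzygy m X V -> stable_right_approx C f ->
  exists f' : {linear V -> A}, stable_right_approx (syzygy_class m C) f'.
Proof.
elim: m B X C f => [|m IHm] B X C f gC /=.
  by move=> <- <- st; exists f => N [N' CN <-]; exact: st.
move=> [B1 [PB [i [p [pPB ip syB]]]]] [X1 [PX [i' [p' [pPX ip' syX]]]]] st.
have [ii ipE ps] := ip; have [ii' ipE' ps'] := ip'.
have [ft ftE] := pPX.2 _ _ p (f \o p') ps.
have [|f1 f1E] := @ses_lift _ _ _ _ i p _ (ft \o i') ip.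
  by move=> x; rewrite /= ftE /= (ses0 _ ip') linear0.
have gC1 N : syzygy_class 1 C N -> gorproj N.
  by move=> [N' /gC gN' sy]; apply: syzygy_resolving gp_resolving gN' sy.
(* It suffices to treat one syzygy, with the first syzygies of [C] as the new class. *)
suff st1 : stable_right_approx (syzygy_class 1 C) f1.
  have [f' f'P] := IHm _ _ _ _ gC1 syB syX st1; exists f' => N [N' CN'].
  move=> [K [P [j [q [pP jq sy]]]]]; apply: f'P; exists K => //; exists N' => //.
  by exists K, P, j, q.
move=> N [N' CN' [K [Q [j [q [pQ jq /= e]]]]]] g; subst K.
have [ji jqE qs] := jq.
have [e eE] := (ext_zero0 _ _).1 (gp_ext_proj (gC _ CN') pPB) _ _ _ _ jq (i \o g).
have [|g' g'E] := @ses_factor _ _ _ _ j q _ (p \o e) jq.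
  by move=> x; rewrite /= eE /= (ses0 _ ip).
have [h [P [a [b [pP hab]]]]] := st _ CN' g'.
have [hQ hQE] := pQ.2 _ _ p' (h \o q) ps'.
have [bQ bQE] := pP.2 _ _ p b ps.
have [|h1 h1E] := @ses_lift _ _ _ _ i' p' _ (hQ \o j) ip'.
  by move=> x; rewrite /= hQE /= (ses0 _ jq) linear0.
(* [e] and [ft \o hQ \+ bQ \o a \o q] induce the same map on [N'], so their difference
   maps into [B1]; on [N] it is [g \- f1 \o h1]. *)
have [|c cE] := @ses_lift _ _ _ _ i p _ ((e \- (ft \o hQ)) \- (bQ \o (a \o q))) ip.
  move=> x; rewrite /= !linearB /= ftE bQE /= hQE -[p (e x)]g'E hab /=.
  by rewrite addrAC addrK subrr.
exists h1, Q, j, c; split=> // x; apply: ii.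
rewrite linearD f1E cE /= h1E eE /= (ses0 _ jq).
by rewrite !linear0 addr0 addrC subrK.
Qed.

(* The Frobenius property of GP and the high syzygies enter as hypotheses: they are
   derived below from the two finite injective dimensions. *)
Hypothesis gp_embed : forall A, gorproj A ->
  exists P C (i : {linear A -> P}) (p : {linear P -> C}),
    [/\ fgproj P, short_exact i p
      & forall u : {linear A -> RR}, exists v : {linear P -> RR}, forall x, v (i x) = u x].
Variable n0 : nat.
Hypothesis gp_syzygy : forall m A W, (n0 <= m)%N -> fgmod A -> syzygy m A W -> gorproj W.

Lemma gp_embed_cosyzygy A : gorproj A ->
  exists P C (i : {linear A -> P}) (p : {linear P -> C}),
    [/\ fgproj P, short_exact i p, gorproj C
      & forall u : {linear A -> RR}, exists v : {linear P -> RR}, forall x, v (i x) = u x].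
Proof.
move=> gA; have [P [C [i [p [pP ip ex]]]]] := gp_embed gA.
exists P, C, i, p; split=> //.
by apply: gp_coker ip gA _ ex; exact: (resolving_proj gp_resolving).
Qed.

Lemma gp_cosyzygy m W : gorproj W -> exists2 Y, gorproj Y & syzygy m Y W.
Proof.
elim: m W => [|m IHm] W gW; first by exists W.
have [P [C [i [p [pP ip gC _]]]]] := gp_embed_cosyzygy gW.
have [Y gY sy] := IHm _ gC; exists Y => //.
by rewrite -addn1; apply: syzygy_trans sy _; exists W, P, i, p.
Qed.

Variables (d : nat) (CM : subcat R).
Hypothesis d_gt0 : (0 < d)%N.
Hypothesis cm_left : forall A, CM A <->
  fgmod A /\ forall X, CM X -> forall n, (n.+1 < d)%N -> ext_zero n A X.
Hypothesis cm_right : forall A, CM A <->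
  fgmod A /\ forall X, CM X -> forall n, (n.+1 < d)%N -> ext_zero n X A.
Hypothesis cm_dvd : forall X Y, CM X -> CM Y ->
  forall n, ~~ (d %| n.+1)%N -> ext_zero n X Y.
Hypothesis cm_ff : functorially_finite (@fgmod R) CM.

Lemma cm_proj P : fgproj P -> CM P.
Proof. by move=> pP; apply/cm_left; split=> [|X _ n _]; [exact: pP.1|exact: ext_proj]. Qed.

Lemma cm_fg A : CM A -> fgmod A. Proof. by case/cm_left. Qed.

Lemma cm_prod A B : CM A -> CM B -> CM (A * B)%type.
Proof.
move=> /cm_right[fA eA] /cm_right[fB eB]; apply/cm_right; split.
  exact: fgmod_ext (ses_prod A B) fA fB.
by move=> X CX n nd; apply: ext_prod; [exact: eA|exact: eB].
Qed.

Lemma cm_retract B B' (s : {linear B -> B'}) (r : {linear B' -> B}) :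
  cancel s r -> fgmod B -> CM B' -> CM B.
Proof.
move=> srK fB /cm_right[_ e]; apply/cm_right; split=> // X CX n nd.
exact: ext_retract srK (e _ CX _ nd).
Qed.

(** A d-th syzygy shifts the degrees 1, ..., d-1 by d, and the new degrees are not
    divisible by d. *)
Lemma cm_syzygy q X W : CM X -> syzygy (d * q) X W -> CM W.
Proof.
elim: q X => [|q IHq] X CX; first by rewrite muln0 => <-.
rewrite mulnS => /syzygy_split[V syV syW]; apply: IHq syW.
have fX := cm_fg CX.
apply/cm_left; split=> [|Y CY n nd].
  exact: (syzygy_resolving (fgmod_resolving noeth) fX syV).
apply/(ext_syzygy noeth n fX (cm_fg CY) syV)/cm_dvd => //.
by rewrite -addnS dvdn_addr // gtnNdvd.
Qed.

Definition CMgp A := CM A /\ gorproj A.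

(** For [X] in [CM] with syzygy [V] of the same order, Ext(Y, X) = Ext(W, V) in each
    positive degree: [gp_shift] replaces [X] by [V] and raises the degree by d * q,
    and passing from [Y] to [W] lowers it again. *)
Lemma CMgp_cosyzygy q W Y : CMgp W -> gorproj Y -> syzygy (d * q) Y W -> CMgp Y.
Proof.
move=> [CW gW] gY sy; split=> //; apply/cm_left; split=> [|X CX n nd]; first exact: gY.1.
have fX := cm_fg CX.
have [V syV] := syzygy_exists (d * q) (fgmod_resolving noeth) fX.
have CV : CM V by exact: cm_syzygy syV.
apply/(gp_shift n gY fX syV); rewrite addnC.
apply/(ext_syzygy noeth n gY.1 (cm_fg CV) sy).
by case/cm_left: CW => _; exact.
Qed.

Lemma CMgp_syzygy X V : CM X -> syzygy (d * n0) X V -> CMgp V.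
Proof.
move=> CX sy; split; first exact: cm_syzygy sy.
by apply: gp_syzygy sy; [rewrite leq_pmull|exact: cm_fg].
Qed.

Lemma CMgp_cosyzygy_exists q W : CMgp W -> exists2 Y, CMgp Y & syzygy (d * q) Y W.
Proof.
move=> cW; have [Y gY sy] := gp_cosyzygy (d * q) cW.2.
by exists Y => //; exact: CMgp_cosyzygy sy.
Qed.

(** Any [Z] in [CM] can be replaced by the cosyzygy [Y] in [CMgp] of a high syzygy of
    [Z] without changing the Ext groups from [A]. *)
Lemma CMgp_left A : gorproj A ->
  (forall X, CMgp X -> forall n, (n.+1 < d)%N -> ext_zero n A X) -> CM A.
Proof.
move=> gA e; apply/cm_left; split=> [|Z CZ n nd]; first exact: gA.1.
have fZ := cm_fg CZ.
have [W sy] := syzygy_exists (d * n0) (fgmod_resolving noeth) fZ.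
have cW := CMgp_syzygy CZ sy.
have [Y cY syY] := CMgp_cosyzygy_exists n0 cW.
apply/(gp_shift n gA fZ sy)/(gp_shift n gA (cm_fg cY.1) syY).
exact: e.
Qed.

Lemma CMgp_prod_proj V P : CMgp V -> fgproj P -> CMgp (V * P)%type.
Proof.
move=> [CV gV] pP; split; first exact: (cm_prod CV (cm_proj pP)).
exact: (resolving_ext gp_resolving (ses_prod V P) gV (resolving_proj gp_resolving pP)).
Qed.

Lemma extends_to_proj A P0 P (i : {linear A -> P0}) C (q : {linear P0 -> C}) :
  fgproj P -> short_exact i q -> gorproj C -> forall a : {linear A -> P},
  exists b : {linear P0 -> P}, forall x, b (i x) = a x.
Proof. by move=> pP iq gC a; exact: ((ext_zero0 _ _).1 (gp_ext_proj gC pP) _ _ _ _ iq a). Qed.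

(** An approximation by [CM] of a cosyzygy [B] of [A] gives, after taking syzygies, a
    stable approximation of [A]. Adding an embedding of [A] in a projective absorbs the
    maps through projectives and makes the approximation injective. *)
Lemma CMgp_left_approx A : gorproj A ->
  exists N (f : {linear A -> N}), [/\ CMgp N, injective f,
    (forall u : {linear A -> RR}, exists v : {linear N -> RR}, forall x, v (f x) = u x)
    & forall N', CMgp N' -> forall g : {linear A -> N'},
        exists h : {linear N -> N'}, forall x, g x = h (f x)].
Proof.
move=> gA; have [B gB syB] := gp_cosyzygy (d * n0) gA.
have [_ [X [f [CX fP]]]] := cm_ff gB.1.
have [V syV] := syzygy_exists (d * n0) (fgmod_resolving noeth) (cm_fg CX).
have st : stable_left_approx CMgp f.
  move=> N [CN gN] g; have [h hE] := fP _ CN g.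
  exists h, 'rV[R]_0, \0, \0; split; first exact: row_fgproj.
  by move=> x; rewrite hE /= addr0.
have [f1 st1] := stable_left_syzygy gB syB syV st.
have [P0 [C [i [p [pP0 ip gC ex]]]]] := gp_embed_cosyzygy gA.
have [f' f'E] := pair_exists f1 i; have [ii _ _] := ip.
exists (V * P0)%type, f'; split.
- exact: (CMgp_prod_proj (CMgp_syzygy CX syV)).
- by move=> x y; rewrite !f'E => -[_ /ii].
- by move=> u; have [v vE] := ex u; exists (v \o pr2 V P0) => x; rewrite /= f'E /= vE.
move=> N cN g; have [Y cY syY] := CMgp_cosyzygy_exists n0 cN.
have [|h [P [a [b [pP hab]]]]] := st1 N _ g; first by exists Y.
have [a' a'E] := extends_to_proj pP ip gC a.
have [k kE] := copair_exists h (b \o a'); exists k => x.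
by rewrite f'E kE /= a'E hab.
Qed.

(** The dual of [CMgp_left_approx]: a projective cover of [A] absorbs the maps through
    projectives. *)
Lemma CMgp_right_approx A : gorproj A ->
  exists N (f : {linear N -> A}), CMgp N /\
    forall N', CMgp N' -> forall g : {linear N' -> A},
        exists h : {linear N' -> N}, forall x, g x = f (h x).
Proof.
move=> gA; have [B gB syB] := gp_cosyzygy (d * n0) gA.
have [[X [f [CX fP]]] _] := cm_ff gB.1.
have [V syV] := syzygy_exists (d * n0) (fgmod_resolving noeth) (cm_fg CX).
have st : stable_right_approx CMgp f.
  move=> N [CN gN] g; have [h hE] := fP _ CN g.
  exists h, 'rV[R]_0, \0, \0; split; first exact: row_fgproj.
  by move=> x; rewrite hE /= addr0.
have [f1 st1] := stable_right_syzygy (fun N (cN : CMgp N) => cN.2) syB syV st.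
have [P0 [K [i [p [pP0 [_ _ ps]]]]]] := cover_exists gA.1.
have [f' f'E] := copair_exists f1 p.
exists (V * P0)%type, f'; split; first exact: (CMgp_prod_proj (CMgp_syzygy CX syV)).
move=> N cN g; have [Y cY syY] := CMgp_cosyzygy_exists n0 cN.
have [|h [P [a [b [pP hab]]]]] := st1 N _ g; first by exists Y.
have [b' b'E] := pP.2 _ _ p b ps.
have [k kE] := pair_exists h (b' \o a); exists k => x.
by rewrite kE f'E /= b'E hab.
Qed.

(** With successive left approximations 0 -> Y_j -> N_j -> Y_(j+1) -> 0 starting at
    [Y_0 = A], each [Y_j] is left orthogonal to [CMgp] in degrees 1, ..., j, and
    Ext^1(Y_1, A) embeds in Ext^j(Y_j, A). At [j = d-1] the first property puts [Y_j]
    in [CMgp], whence Ext^1(Y_1, A) = 0 and [A] is a summand of [N_0]. *)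
Lemma CMgp_right A : gorproj A ->
  (forall X, CMgp X -> forall n, (n.+1 < d)%N -> ext_zero n X A) -> CM A.
Proof.
move=> gA eA; case: (leqP d 1) => d1.
  apply: CMgp_left => // X _ n nd; by have := leq_trans nd d1.
have fA := gA.1.
have step Y : gorproj Y -> exists N Z (f : {linear Y -> N}) (g : {linear N -> Z}),
    [/\ CMgp N, gorproj Z, short_exact f g &
     forall N', CMgp N' -> forall g : {linear Y -> N'},
        exists h : {linear N -> N'}, forall x, h (f x) = g x].
  move=> gY; have [N [f [cN fi ex fP]]] := CMgp_left_approx gY.
  have [Z [g fg]] := cokernel_exists fi.
  exists N, Z, f, g; split=> //; first exact: gp_coker fg gY cN.2 ex.
  by move=> N' cN' k; have [h hE] := fP _ cN' k; exists h.
have right0 Y N Z (f : {linear Y -> N}) (g : {linear N -> Z}) :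
    gorproj Y -> gorproj Z -> CMgp N -> short_exact f g ->
    (forall N', CMgp N' -> forall g : {linear Y -> N'},
        exists h : {linear N -> N'}, forall x, h (f x) = g x) ->
    forall X, CMgp X -> ext_zero 0 Z X.
  move=> gY gZ cN fg fP X cX; apply/ext_zero0/(ext1_right fg gY.1 gZ.1).
    apply/ext_zero0; case/cm_left: cN.1 => _; apply => //; exact: cX.1.
  exact: fP.
have [N0 [A1 [f0 [g0 [cN0 gA1 fg0 f0P]]]]] := step _ gA.
have chain j : (j.+1 < d)%N -> exists Y, [/\ gorproj Y,
    (forall X, CMgp X -> forall n, (n <= j)%N -> ext_zero n Y X)
    & ext_zero j Y A -> ext_zero 0 A1 A].
  elim: j => [|j IHj] jd.
    exists A1; split=> // X cX n; rewrite leqn0 => /eqP->.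
    exact: (right0 _ _ _ _ _ gA gA1 cN0 fg0 f0P).
  have [Y [gY eY YA]] := IHj (ltnW jd).
  have [N [Z [f [g [cN gZ fg fP]]]]] := step _ gY.
  exists Z; split=> // [X cX [|n] nj|ZA].
  - exact: (right0 _ _ _ _ _ gY gZ cN fg fP).
  - apply: (ext_right noeth fg gY.1 gZ.1 cX.2.1); last exact: eY.
    case/cm_left: cN.1 => _; apply; first exact: cX.1.
    exact: leq_ltn_trans jd.
  apply: YA; apply: (ext_left noeth fg gY.1 gZ.1 fA) ZA.
  by apply: eA => //; exact: ltnW.
(* [chain j] produces [Y_(j+1)], so the last cokernel has index d - 2. *)
have [|Y [gY eY YA]] := chain d.-2; first by case: (d) d1 => [|[|]].
have e2 : (d.-2.+2 = d)%N by case: (d) d1 => [|[|]].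
have cY : CMgp Y.
  split=> //; apply: CMgp_left => // X cX n nd; apply: eY => //.
  by rewrite -2!ltnS e2.
have /ext_zero0 A1A : ext_zero 0 A1 A by apply/YA/eA; rewrite ?e2.
have [r rE] := A1A _ _ _ _ fg0 idfun.
exact: cm_retract rE fA cN0.1.
Qed.

End GorensteinProjectives.

(** * Finite-dimensional algebras are Noetherian *)

Section Noetherian.

(** By finite dimension, a subspace contained in [P] which is not all of it can be
    enlarged only finitely often. *)
Lemma vspace_of_closed (k : fieldType) (V : vectType k) (P : V -> Prop) :
  P 0 -> (forall a x y, P x -> P y -> P (a *: x + y)) ->
  exists U : {vspace V}, forall w, P w <-> w \in U.
Proof.
move=> P0 Pl.
suff grow m (U : {vspace V}) : (forall w, w \in U -> P w) -> (\dim {:V} - \dim U <= m)%N ->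
    exists U : {vspace V}, forall w, P w <-> w \in U.
  by apply: (grow _ 0%VS _ (leqnn _)) => w; rewrite memv0 => /eqP->.
elim: m U => [|m IHm] U UP dU.
  exists U => w; split=> [_|/UP//]; suff -> : U = fullv by exact: memvf.
  by apply/eqP; rewrite -(dimv_leqif_eq (subvf U)) eqn_leq dimvS ?subvf // -subn_eq0 -leqn0.
have [[w [Pw /negP wU]]|none] := classic (exists w, P w /\ w \notin U); last first.
  exists U => w; split=> [Pw|/UP//]; apply/negPn/negP => wU; apply: none.
  by exists w.
apply: (IHm (U + <[w]>)%VS).
  move=> x /memv_addP[u uU [v /vlineP[c ->] ->]]; rewrite addrC; apply: Pl => //; exact: UP.
have lt : (\dim U < \dim (U + <[w]>))%N.
  rewrite (ltn_leqif (dimv_leqif_sup (addvSl _ _))); apply/negP => /subvP sub; apply: wU.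
  by apply: sub; apply: (subvP (addvSr U _)); exact: memv_line.
rewrite leq_subLR; apply: leq_trans (leq_add lt (leqnn m)).
by rewrite addSnnS -leq_subLR.
Qed.

(** The elements of a free module mapping into [K] form a subspace, and a basis of it
    gives generators of [K]. The map [phi] is a [k]-linear coordinatization of the ring,
    through [z]; it is kept abstract to serve an algebra and its converse alike. *)
Lemma noetherian_of_vect (k : fieldType) (V : vectType k) (R : nzRingType)
    (phi : {additive V -> R}) (z : k -> R) :
  (forall c v, phi (c *: v) = z c * phi v) -> (forall r, exists v, phi v = r) ->
  noetherian R.
Proof.
move=> phiZ phis K E Q f g fg /fgmodP[n [h hs]]; have [fi fgE _] := fg.
pose Psi (w : {ffun 'I_n -> V}) : E := h (\row_i phi (w i)).
have PsiP c w w' : Psi (c *: w + w') = z c *: Psi w + Psi w'.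
  rewrite /Psi -linearP; congr (h _); apply/rowP => i.
  by rewrite !mxE !ffunE raddfD phiZ.
have Psi0 : Psi 0 = 0.
  by rewrite -[RHS](linear0 h); congr (h _); apply/rowP => i; rewrite !mxE ffunE raddf0.
have [||U UP] := @vspace_of_closed _ _ (fun w => g (Psi w) = 0).
- by rewrite Psi0 linear0.
- by move=> c w w' e e'; rewrite PsiP linearP e e' scaler0 addr0.
have lift i : exists y, f y = Psi (tnth (vbasis U) i).
  by apply/fgE/UP/vbasis_mem/mem_tnth.
have [y yE] := choice_fun lift; have [r rE] := row_map_exists y.
apply/fgmodP; exists _, r => x.
have [v vE] := hs (f x); have [b bE] := choice_fun phis.
pose w : {ffun 'I_n -> V} := [ffun i => b (v 0 i)].
have wE : Psi w = f x.
  by rewrite -vE; congr (h _); apply/rowP => i; rewrite mxE ffunE bE.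
have wU : w \in U by apply/UP; rewrite wE (ses0 _ fg).
exists (\row_i z (coord (vbasis U) i w)); apply: fi; rewrite -wE rE linear_sum.
rewrite [in RHS](coord_vbasis wU).
have PsiS : forall (I : Type) (s : seq I) (c : I -> k) (u : I -> {ffun 'I_n -> V}),
    Psi (\sum_(i <- s) c i *: u i) = \sum_(i <- s) z (c i) *: Psi (u i).
  move=> I s c u; elim: s => [|i s IHs]; first by rewrite !big_nil Psi0.
  by rewrite !big_cons PsiP IHs.
rewrite PsiS; apply: eq_bigr => i _; rewrite mxE linearZ /= yE.
by rewrite (tnth_nth 0).
Qed.

Lemma falg_noetherian (k : fieldType) (L : falgType k) : noetherian L.
Proof.
apply: (@noetherian_of_vect k L L idfun (fun c => c%:A)) => [c v|r]; last by exists r.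
by rewrite /= mulr_algl.
Qed.

Lemma falg_conv_noetherian (k : fieldType) (L : falgType k) : noetherian L^c.
Proof.
apply: (@noetherian_of_vect k L L^c idfun (fun c => c%:A)) => [c v|r]; last by exists r.
by rewrite /= -[RHS]/((v : L) * c%:A) mulr_algr.
Qed.
End Noetherian.

(** * Duals of Gorenstein projectives *)

Section Duality.
Variable L : nzRingType.
Let R : nzRingType := L^c.
Hypotheses (noethL : noetherian L) (noethR : noetherian R).
Let LL : lmodType L := L^o.
Let RR : lmodType R := R^o.
Variable nL : nat.
Hypothesis injL : injdim_le nL LL.

(** The evaluation pairing between the right module [L^n] and its dual, the left
    module [L^n], with values computed in [L]. *)
Definition pairing n (y : 'rV[L]_n) (v : 'rV[R]_n) : L := \sum_j y 0 j * (v 0 j : L).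

Lemma pairing_delta_r n (y : 'rV[L]_n) j : pairing y (delta_mx 0 j) = y 0 j.
Proof.
rewrite /pairing (bigD1 j) //= big1 ?addr0.
  by rewrite !mxE !eqxx; exact: mulr1.
by move=> i ij; rewrite mxE (negPf ij); exact: mulr0.
Qed.

Lemma pairing_delta_l n (v : 'rV[R]_n) j : pairing (delta_mx 0 j) v = v 0 j.
Proof.
rewrite /pairing (bigD1 j) //= big1 ?addr0.
  by rewrite !mxE !eqxx mul1r.
by move=> i ij; rewrite mxE (negPf ij) mul0r.
Qed.

Lemma pairing_linear_l n a (y y' : 'rV[L]_n) v :
  pairing (a *: y + y') v = a * pairing y v + pairing y' v.
Proof.
rewrite /pairing mulr_sumr -big_split; apply: eq_bigr => j _.
by rewrite !mxE mulrDl mulrA.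
Qed.

Lemma pairing_eq_l n (y y' : 'rV[L]_n) : (forall v, pairing y v = pairing y' v) -> y = y'.
Proof. by move=> e; apply/rowP => j; rewrite -!pairing_delta_r e. Qed.

Lemma pairing_eq_r n (v v' : 'rV[R]_n) : (forall y, pairing y v = pairing y v') -> v = v'.
Proof. by move=> e; apply/rowP => j; rewrite -!pairing_delta_l e. Qed.

Lemma pairing_form_r n (F : {linear 'rV[R]_n -> RR}) :
  exists y : 'rV[L]_n, forall v, F v = pairing y v.
Proof.
exists (\row_j (F (delta_mx 0 j) : L)) => v; rewrite row_map_delta.
by apply: eq_bigr => j _; rewrite mxE.
Qed.

Lemma pairing_form_l n (F : {linear 'rV[L]_n -> LL}) :
  exists v : 'rV[R]_n, forall y, F y = pairing y v.
Proof.
exists (\row_j (F (delta_mx 0 j) : R)) => y; rewrite row_map_delta.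
by apply: eq_bigr => j _; rewrite mxE.
Qed.

Lemma pairing_r_exists n (y : 'rV[L]_n) :
  exists F : {linear 'rV[R]_n -> RR}, forall v, F v = pairing y v.
Proof.
have [F FE] := @row_map_exists R n RR (fun j => y 0 j).
by exists F => v; rewrite FE.
Qed.

Lemma pairing_l_exists n (v : 'rV[R]_n) :
  exists F : {linear 'rV[L]_n -> LL}, forall y, F y = pairing y v.
Proof.
have [F FE] := @row_map_exists L n LL (fun j => v 0 j).
by exists F => y; rewrite FE.
Qed.

(** [S] is the left [L]-module Hom(A, R), realized inside [L^n] by composing with the
    generators [g] of [A]. *)
Definition is_dual n (A : lmodType R) (g : {linear 'rV[R]_n -> A}) (S : lmodType L)
    (i : {linear S -> 'rV[L]_n}) :=
  injective i /\ forall y, (exists f : {linear A -> RR}, forall v, f (g v) = pairing y v) <->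
    exists x, i x = y.

Lemma dual_exists n (A : lmodType R) (g : {linear 'rV[R]_n -> A}) :
  exists (S : lmodType L) (i : {linear S -> 'rV[L]_n}), is_dual g i.
Proof.
apply: submodule_exists => [|a y y' [f fE] [f' f'E]].
  by exists \0 => v; rewrite /pairing big1 // => j _; rewrite mxE mul0r.
have [|h hE] := @lin_exists R A RR (fun x => (a * (f x : L) + (f' x : L) : L)).
  move=> b x x'; rewrite !linearP /=.
  rewrite -[b *: f x]/((f x : L) * (b : L) : L) -[b *: f' x]/((f' x : L) * (b : L) : L).
  rewrite -[b *: _]/((a * (f x : L) + (f' x : L)) * (b : L) : L).
  by rewrite mulrDl mulrDr mulrA addrACA.
by exists h => v; rewrite hE fE f'E pairing_linear_l.
Qed.

(** Dualizing [K -> R^n -> A] stays exact when Ext^1(A, R) = 0. *)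
Lemma dual_ses n m (A K : lmodType R) (g : {linear 'rV[R]_n -> A})
    (k : {linear K -> 'rV[R]_n}) (h : {linear 'rV[R]_m -> K}) (S T : lmodType L)
    (i : {linear S -> 'rV[L]_n}) (j : {linear T -> 'rV[L]_m}) :
  short_exact k g -> surj h -> ext1_zero A RR -> is_dual g i -> is_dual h j ->
  exists p : {linear 'rV[L]_n -> T}, short_exact i p /\
    forall y u, pairing (j (p y)) u = pairing y (k (h u)).
Proof.
move=> kg hs AR [ii iP] [ji jP]; have [_ _ gs] := kg.
have ex y : exists t, forall u, pairing (j t) u = pairing y (k (h u)).
  have [F FE] := pairing_r_exists y.
  have [z zE] := pairing_form_r (F \o (k \o h)).
  have [|t tE] := (jP z).1; first by exists (F \o k).
  by exists t => u; rewrite tE -zE /= FE.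
have [c cE] := choice_fun ex.
have [|p pE] := @lin_exists L 'rV[L]_n T c.
  move=> a y y'; apply: ji; apply: pairing_eq_l => u.
  by rewrite linearP pairing_linear_l !cE pairing_linear_l.
exists p; split=> [|y u]; last by rewrite pE.
split=> // [y|t].
  rewrite -iP; split=> [py0|[f fE]].
    have [F FE] := pairing_r_exists y.
    have [|f fE] := @ses_factor _ _ _ _ k g _ F kg.
      move=> x; have [u <-] := hs x; rewrite FE -cE -pE py0 linear0.
      by rewrite /pairing big1 // => l _; rewrite mxE mul0r.
    by exists f => v; rewrite fE FE.
  apply: ji; apply: pairing_eq_l => u; rewrite pE cE -fE (ses0 _ kg) linear0 linear0.
  by rewrite /pairing big1 // => l _; rewrite mxE mul0r.
have [f fE] := (jP (j t)).2 (ex_intro _ t erefl).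
have [F FE] := AR _ _ _ _ kg f; have [y yE] := pairing_form_r F.
exists y; apply: ji; apply: pairing_eq_l => u.
by rewrite pE cE -yE FE fE.
Qed.

Lemma dual_fg n (A : lmodType R) (g : {linear 'rV[R]_n -> A}) (S : lmodType L)
  (i : {linear S -> 'rV[L]_n}) : is_dual g i -> fgmod S.
Proof.
move=> [ii _]; have [Q [p ip]] := cokernel_exists ii.
exact: (noethL ip (row_fgproj _ _).1).
Qed.

Lemma gp_pres_ker (A K : lmodType R) n (g : {linear 'rV[R]_n -> A})
  (k : {linear K -> 'rV[R]_n}) : gorproj A -> short_exact k g -> gorproj K.
Proof. by move=> gA kg; exact: (resolving_ker (gp_resolving noethR) kg (row_fgproj _ _) gA). Qed.

(** By [dual_ses] the dual of [A] is a syzygy of the dual of a syzygy of [A], which is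
    again Gorenstein projective. *)
Lemma dual_syzygy m n (A : lmodType R) (g : {linear 'rV[R]_n -> A}) (S : lmodType L)
    (i : {linear S -> 'rV[L]_n}) :
  gorproj A -> surj g -> is_dual g i -> exists2 U, fgmod U & syzygy m U S.
Proof.
elim: m n A g S i => [|m IHm] n A g S i gA gs st; first by exists S => //; exact: dual_fg st.
have [K [k kg]] := kernel_exists gs.
have gK := gp_pres_ker gA kg.
have /fgmodP[q [h hs]] := gK.1.
have [T [j jst]] := dual_exists h.
have [p [ip _]] := dual_ses kg hs ((ext_zero0 _ _).1 (gA.2 0)) st jst.
have [U fU sy] := IHm _ _ _ _ _ gK hs jst; exists U => //.
rewrite -addn1; apply: syzygy_trans sy _; exists S, 'rV[L]_n, i, p.
by split=> //; exact: row_fgproj.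
Qed.

Lemma ext1_dual n (A : lmodType R) (g : {linear 'rV[R]_n -> A}) (S : lmodType L)
    (i : {linear S -> 'rV[L]_n}) :
  gorproj A -> surj g -> is_dual g i -> ext1_zero S LL.
Proof.
move=> gA gs st; have [U fU sy] := dual_syzygy nL gA gs st.
exact: (ext1_injdim noethL fU injL sy).
Qed.

(** Let [a] be the image of [x] in [R^n]. If all forms kill [a], evaluation at [x] factors
    through the dual [T] of the syzygy [K], and extends from there to [L^m] because the
    next dual has no Ext^1 to [L]. So it is evaluation at some [w] in [R^m], which
    shows that [x] comes from [K]. *)
Lemma gp_torsionless (A : lmodType R) a : gorproj A ->
  (forall f : {linear A -> RR}, f a = 0) -> a = 0.
Proof.
move=> gA fa.
have /fgmodP[n [g gs]] := gA.1; have [K [k kg]] := kernel_exists gs.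
have gK := gp_pres_ker gA kg.
have /fgmodP[m [h hs]] := gK.1; have [K1 [k1 kh]] := kernel_exists hs.
have gK1 := gp_pres_ker gK kh.
have /fgmodP[m1 [h1 h1s]] := gK1.1.
have [S [i ist]] := dual_exists g.
have [T [j jst]] := dual_exists h.
have [T1 [j1 j1st]] := dual_exists h1.
have [p [ip pP]] := dual_ses kg hs ((ext_zero0 _ _).1 (gA.2 0)) ist jst.
have [p1 [jp1 _]] := dual_ses kh h1s ((ext_zero0 _ _).1 (gK.2 0)) jst j1st.
have [x xE] := gs a; have [F FE] := pairing_l_exists x.
have [|G GE] := @ses_factor _ _ _ _ i p _ F ip.
  move=> w; rewrite FE; have [f fE] := (ist.2 (i w)).2 (ex_intro _ w erefl).
  by rewrite -fE xE fa.
have [H HE] := ext1_dual gK1 h1s j1st jp1 G.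
have [w wE] := pairing_form_l H.
suff xw : x = k (h w) by rewrite -xE xw (ses0 _ kg).
by apply: pairing_eq_r => y; rewrite -FE -GE -HE wE pP.
Qed.

(** Finitely many generators of the dual of [A] form the components of a map
    [A -> R^q] through which every form on [A] factors; it is injective because [A] is
    torsionless. *)
Lemma gp_embed_free (A : lmodType R) : gorproj A ->
  exists (P C : lmodType R) (i : {linear A -> P}) (p : {linear P -> C}),
    [/\ fgproj P, short_exact i p
      & forall u : {linear A -> RR}, exists v : {linear P -> RR}, forall x, v (i x) = u x].
Proof.
move=> gA; have /fgmodP[n [g gs]] := gA.1.
have [S [i ist]] := dual_exists g.
have /fgmodP[q [c cs]] := dual_fg ist.
have ex l : exists f : {linear A -> RR}, forall v, f (g v) = pairing (i (c (delta_mx 0 l))) v.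
  by apply/(ist.2 _).2; exists (c (delta_mx 0 l)).
have [f fE] := choice_fun ex.
have [|e eE] := @lin_exists R A 'rV[R]_q (fun x => \row_l f l x).
  by move=> a x y; apply/rowP => l; rewrite !mxE linearP.
have ext_e (u : {linear A -> RR}) : exists v : {linear 'rV[R]_q -> RR}, forall x, v (e x) = u x.
  have [y yE] := pairing_form_r (u \o g).
  have [|w wE] := (ist.2 y).1; first by exists u.
  have [a aE] := cs w.
  have [v vE] := @row_map_exists R q RR (fun l => a 0 l).
  exists v => x; have [z <-] := gs x; rewrite vE eE -[u _]/((u \o g) z) yE -wE -aE.
  rewrite (row_map_delta c) linear_sum.
  have -> : forall s : seq 'I_q, pairing (\sum_(l <- s) i (a 0 l *: c (delta_mx 0 l))) z =
      \sum_(l <- s) a 0 l * pairing (i (c (delta_mx 0 l))) z.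
    elim=> [|l s IHs]; first by rewrite !big_nil /pairing big1 // => l _; rewrite mxE mul0r.
    by rewrite !big_cons linearZ /= pairing_linear_l IHs.
  by apply: eq_bigr => l _; rewrite mxE fE.
have ei : injective e.
  move=> x x' xx'; apply/eqP; rewrite -subr_eq0; apply/eqP/(gp_torsionless gA) => u.
  by have [v <-] := ext_e u; rewrite linearB xx' subrr linear0.
have [C [p ep]] := cokernel_exists ei.
by exists 'rV[R]_q, C, e, p; split=> //; exact: row_fgproj.
Qed.

End Duality.

Lemma gp_syzygy_injdim (R : nzRingType) (n m : nat) (A W : lmodType R) : noetherian R ->
  injdim_le n (R^o : lmodType R) -> (n <= m)%N -> fgmod A -> syzygy m A W -> gorproj W.
Proof.
move=> noeth inj nm fA sy; split=> [|k V syV].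
  exact: (syzygy_resolving (fgmod_resolving noeth) fA sy).
have := syzygy_trans sy syV.
have -> : (m + k = (m + k - n) + n)%N by rewrite subnK // (leq_trans nm) ?leq_addr.
move=> /syzygy_split[A' syA' syV'].
exact: (ext1_injdim noeth (syzygy_resolving (fgmod_resolving noeth) fA syA') inj syV').
Qed.

(** * The intersection with the Gorenstein projectives *)

Theorem corollary1p3 (k : fieldType) (L : falgType k) (d : nat)
    (CM : subcat L^c) :
  (0 < d)%N ->
  Iwanaga_Gorenstein L ->
  dZ_cluster_tilting (@fgmod L^c) d CM ->
  dZ_cluster_tilting (@Gorenstein_projective L^c) d
    (fun M : lmodType L^c => CM M /\ Gorenstein_projective M).
Proof.
move=> d_gt0 [[nL injL] [nR injR]] [[CMfg CMff CMl CMr _ _] CMdvd].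
have noethL : noetherian L := @falg_noetherian k L.
have noethR : noetherian L^c := @falg_conv_noetherian k L.
have fgr := fgmod_resolving noethR.
have range n : (1 <= n.+1 <= d.-1)%N = (n.+1 < d)%N.
  by case: (d) d_gt0 => // d' _; rewrite ltnS.
have cm_left A : CM A <->
    fgmod A /\ forall X, CM X -> forall n, (n.+1 < d)%N -> ext_zero n A X.
  rewrite CMl; split=> -[fA e]; split=> // X CX.
    move=> n nd; apply/(Ext_zero_resolving noethR n fgr fA (CMfg _ CX)).
    by apply: e; rewrite ?range.
  move=> [//|n]; rewrite range => nd.
  by apply/(Ext_zero_resolving noethR n fgr fA (CMfg _ CX)); exact: e.
have cm_right A : CM A <->
    fgmod A /\ forall X, CM X -> forall n, (n.+1 < d)%N -> ext_zero n X A.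
  rewrite CMr; split=> -[fA e]; split=> // X CX.
    move=> n nd; apply/(Ext_zero_resolving noethR n fgr (CMfg _ CX) fA).
    by apply: e; rewrite ?range.
  move=> [//|n]; rewrite range => nd.
  by apply/(Ext_zero_resolving noethR n fgr (CMfg _ CX) fA); exact: e.
have cm_dvd X Y : CM X -> CM Y -> forall n, ~~ (d %| n.+1)%N -> ext_zero n X Y.
  move=> CX CY n nd; apply/(Ext_zero_resolving noethR n fgr (CMfg _ CX) (CMfg _ CY)).
  exact: CMdvd.
have embed := gp_embed_free noethL noethR injL.
have gsyz m A W := @gp_syzygy_injdim _ nR m A W noethR injR.
have gpE := gorprojP noethR.
have GPr : resolving (@Gorenstein_projective L^c).
  have gr := gp_resolving noethR.
  split=> [A /gpE[]//|P pP|K E Q f g fg /gpE gK /gpE gQ|K P Q f g fg pP /gpE gQ].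
  - exact/gpE/(resolving_proj gr).
  - exact/gpE/(resolving_ext gr fg).
  - exact/gpE/(resolving_ker gr fg).
have Ext_ext := @Ext_zero_resolving _ noethR _ _ _ _ GPr.
have cmP : forall P, fgproj P -> CM P by exact: (cm_proj noethR cm_left).
split; last first.
  move=> X Y [CX gX] [CY gY] [|n] nd; first by rewrite dvdn0 in nd.
  by apply/Ext_ext => //; exact: cm_dvd.
split=> [A []//|A /gpE gA|A|A|A gA|A gA].
- split.
    have [N [f [[CN gN] fP]]] :=
      CMgp_right_approx noethR embed gsyz d_gt0 cm_left cm_right cm_dvd CMff gA.
    exists N, f; split; first by split=> //; exact/gpE.
    by move=> N' [CN' /gpE gN']; exact: fP.
  have [N [f [[CN gN] _ _ fP]]] :=
      CMgp_left_approx noethR embed gsyz d_gt0 cm_left cm_right cm_dvd CMff gA.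
  exists N, f; split; first by split=> //; exact/gpE.
  by move=> N' [CN' /gpE gN']; exact: fP.
- split=> [[CA gA]|[gA e]]; split=> //.
    move=> X [CX gX] [//|n]; rewrite range => nd; apply/Ext_ext => //.
    by case/cm_left: CA => _; apply.
  apply: (CMgp_left noethR embed gsyz d_gt0 cm_left cm_dvd); first exact/gpE.
  move=> X [CX /gpE gX] n nd; apply/Ext_ext => //.
  by apply: e; rewrite ?range.
- split=> [[CA gA]|[gA e]]; split=> //.
    move=> X [CX gX] [//|n]; rewrite range => nd; apply/Ext_ext => //.
    by case/cm_right: CA => _; apply.
  apply: (CMgp_right noethR embed gsyz d_gt0 cm_left cm_right cm_dvd CMff); first exact/gpE.
  move=> X [CX /gpE gX] n nd; apply/Ext_ext => //.
  by apply: e; rewrite ?range.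
- have /gpE/(gp_embed_cosyzygy noethR embed)[P [C [i [p [pP ip gC _]]]]] := gA.
  have GP := resolving_proj GPr pP.
  exists C, (Conflation ip (And3 gA GP ((gpE C).2 gC))).
  by split=> //; exact: cmP.
have [P [K [f [g [pP fg]]]]] := cover_exists (resolving_fg GPr gA).
have GP := resolving_proj GPr pP.
exists K, (Conflation fg (And3 (resolving_ker GPr fg pP gA) GP gA)).
by split=> //; exact: cmP.
Qed.
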